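(* Let $k$ be a field and let $D\ge D_0$ be two integers. Let $E(D_0,D)$ be the set of all graded right modules (respectively, of all graded bimodules) $M$ over connected graded $k$-algebras $A$ (where $A$ is allowed to vary) such that $A$ and $M$ are each generated by at most $D$ elements, the generators of $M$ have degrees at least $D_0$, and the generators and relations of both $A$ and $M$ have degrees at most $D$. Then the set of all Hilbert series of modules (respectively, of bimodules) from $E(D_0,D)$ has no infinite ascending chains with respect to the lexicographical order: there is no infinite sequence $M_1,M_2,\dots$ in $E(D_0,D)$ with $M_1(z)<_{lex}M_2(z)<_{lex}\cdots$.
   Context: A connected graded algebra over $k$ is an associative algebra $A=\bigoplus_{i\ge 0}A_i$ with $A_0=k$. Generators and relations are minimal homogeneous ones: for an algebra $A$ they correspond to bases of $\mathrm{Tor}_1^A(k,k)$ and $\mathrm{Tor}_2^A(k,k)$; for a right module $M$ they correspond to bases of $\mathrm{Tor}_0^A(M,k)$ and $\mathrm{Tor}_1^A(M,k)$. A graded $A$-bimodule is a graded right module over $A\otimes_k A^{op}$, and its generators and relations are understood as those of a bimodule, i.e. of a module over $A\otimes_k A^{op}$. The Hilbert series of a locally finite graded vector space $V$ is $V(z)=\sum_{i\in\mathbb{Z}}(\dim_k V_i)z^i$. The lexicographical order on series with integer coefficients (with finitely many terms of negative degree): $\sum a_iz^i>_{lex}\sum b_iz^i$ iff there is $q$ with $a_i=b_i$ for all $i<q$ and $a_q>b_q$. *)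

(* Defs.v *)
From HB Require Import structures.
From mathcomp Require Import all_boot all_order all_algebra.
From mathcomp Require Import finmap monalg.

Set Implicit Arguments.
Unset Strict Implicit.
Unset Printing Implicit Defensive.

Import Order.TTheory GRing.Theory Num.Theory.
Local Open Scope ring_scope.

(* Subsets of (infinite-dimensional) spaces are Prop-valued predicates. *)
Definition subpredp (T : Type) (X Y : T -> Prop) := forall t, X t -> Y t.

(* X is an inclusion-minimal generating set of S, for the closure operator
   gen (generated subalgebra, two-sided ideal or right submodule). *)
Definition minimal_generating (T : Type)
    (gen : (T -> Prop) -> (T -> Prop)) (S X : T -> Prop) :=
  (forall t, S t <-> gen X t) /\
  (forall Y, subpredp Y X -> subpredp S (gen Y) -> subpredp X Y).

Definition range_of (I T : Type) (x : I -> T) : T -> Prop :=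
  fun t => exists i, t = x i.

(** Gradings and Hilbert series *)

Section Grading.
Variables (k : fieldType) (V : lmodType k).

Definition subspace (S : V -> Prop) :=
  S 0 /\ forall (c : k) u v, S u -> S v -> S (c *: u + v).

Definition span (X : V -> Prop) : V -> Prop :=
  fun v => forall S, subspace S -> subpredp X S -> S v.

(* V is the internal direct sum of the gr i. *)
Definition grading (I : eqType) (gr : I -> V -> Prop) :=
  [/\ forall i, subspace (gr i),
      forall v, exists (s : seq I) (f : I -> V),
        (forall i, gr i (f i)) /\ v = \sum_(i <- s) f i
    & forall (s : seq I) (f : I -> V), uniq s -> (forall i, gr i (f i)) ->
        \sum_(i <- s) f i = 0 -> forall i, i \in s -> f i = 0].

Definition has_dim (S : V -> Prop) (n : nat) :=
  exists b : 'I_n -> V,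
    (forall v, S v <-> exists c : 'I_n -> k, v = \sum_i c i *: b i) /\
    (forall c : 'I_n -> k, \sum_i c i *: b i = 0 -> forall i, c i = 0).

(* The series \sum_i h_i z^i is represented by the function i |-> h_i. *)
Definition hilbert_series (gr : int -> V -> Prop) (h : int -> int) :=
  forall i, exists2 n : nat, has_dim (gr i) n & h i = n%:Z.

End Grading.

Definition lex_lt (a b : int -> int) :=
  exists q : int, (forall i, i < q -> a i = b i) /\ a q < b q.

(** Connected graded algebras, presented by generators and relations *)

Definition connected_graded (k : fieldType) (A : algType k)
    (gr : nat -> A -> Prop) :=
  [/\ grading gr,
      forall i j a b, gr i a -> gr j b -> gr (i + j)%N (a * b)
    & forall a, gr 0%N a <-> exists c : k, a = c%:A].

Section Generated.
Variables (k : fieldType) (A : lalgType k).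

Definition subalgebra (S : A -> Prop) :=
  [/\ subspace S, S 1 & forall a b, S a -> S b -> S (a * b)].

Definition subalg_gen (X : A -> Prop) : A -> Prop :=
  fun a => forall S, subalgebra S -> subpredp X S -> S a.

Definition ideal (S : A -> Prop) :=
  subspace S /\ forall a b, S a -> S (a * b) /\ S (b * a).

Definition ideal_gen (X : A -> Prop) : A -> Prop :=
  fun a => forall S, ideal S -> subpredp X S -> S a.

End Generated.

Notation free_alg k n := {malg k[{fmonom 'I_n}]}.

Section Presentation.
Variables (k : fieldType) (A : algType k) (n : nat).

Definition word_deg (d : 'I_n -> nat) (w : {fmonom 'I_n}) : nat :=
  (\sum_(i <- (w : seq 'I_n)) d i)%N.

Definition free_homog (d : 'I_n -> nat) (q : nat) (p : free_alg k n) :=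
  forall w, w \in msupp p -> word_deg d w = q.

Definition free_eval (x : 'I_n -> A) (p : free_alg k n) : A :=
  \sum_(w <- msupp p) mcoeff w p *: \prod_(i <- (w : seq 'I_n)) x i.

End Presentation.

(* A has at most D minimal homogeneous generators x, and they have degrees at
   most D; the minimal homogeneous relations R between them, i.e. a minimal
   generating set of the kernel of k<X> -> A, have degrees at most D. *)
Definition alg_bounded (k : fieldType) (A : algType k) (gr : nat -> A -> Prop)
    (D : int) :=
  exists (n : nat) (x : 'I_n -> A) (d : 'I_n -> nat)
         (R : free_alg k n -> Prop),
    [/\ n%:Z <= D,
        injective x /\ minimal_generating (@subalg_gen k A)
                         (fun _ => True) (range_of x),
        forall i, gr (d i) (x i) /\ (d i)%:Z <= D,
        minimal_generating (@ideal_gen k (free_alg k n))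
          (fun p => free_eval x p = 0) R
      & forall r, R r -> exists2 q : nat, free_homog d q r & q%:Z <= D].

(** Graded right modules *)

Record rmodule (k : fieldType) (B : algType k) := RModule {
  rmod_sort :> lmodType k;
  ract : rmod_sort -> B -> rmod_sort;
  _ : forall b, linear (ract^~ b);
  _ : forall v, linear (ract v);
  _ : forall v, ract v 1 = v;
  _ : forall v a b, ract v (a * b) = ract (ract v a) b
}.

Section RightModules.
Variables (k : fieldType) (B : algType k).

Definition rsubmodule (M : rmodule B) (S : M -> Prop) :=
  subspace S /\ forall v b, S v -> S (ract v b).

Definition rsubmod_gen (M : rmodule B) (X : M -> Prop) : M -> Prop :=
  fun v => forall S, rsubmodule S -> subpredp X S -> S v.

Definition graded_rmodule (grB : nat -> B -> Prop) (M : rmodule B)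
    (gr : int -> M -> Prop) :=
  grading gr /\
  forall (i : int) (j : nat) v b, gr i v -> grB j b -> gr (i + j%:Z) (ract v b).

Section Free.
Variable m : nat.

Definition free_act (v : {ffun 'I_m -> B}) (b : B) : {ffun 'I_m -> B} :=
  [ffun j => v j * b].

Fact free_act_linearl b : linear (free_act^~ b).
Proof. by move=> c u v; apply/ffunP=> j; rewrite !ffunE mulrDl scalerAl. Qed.

Fact free_act_linearr v : linear (free_act v).
Proof. by move=> c a b; apply/ffunP=> j; rewrite !ffunE mulrDr scalerAr. Qed.

Fact free_act1 v : free_act v 1 = v.
Proof. by apply/ffunP=> j; rewrite ffunE mulr1. Qed.

Fact free_actM v a b : free_act v (a * b) = free_act (free_act v a) b.
Proof. by apply/ffunP=> j; rewrite !ffunE mulrA. Qed.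

Definition free_rmod : rmodule B :=
  RModule free_act_linearl free_act_linearr free_act1 free_actM.

(* The component of degree q when the j-th basis vector has degree e j. *)
Definition free_rmod_gr (grB : nat -> B -> Prop) (e : 'I_m -> int) (q : int)
    (v : {ffun 'I_m -> B}) :=
  forall j, if q - e j is Posz i then grB i (v j) else v j = 0.

Definition free_rmod_eval (M : rmodule B) (y : 'I_m -> M)
    (v : {ffun 'I_m -> B}) : M := \sum_j ract (y j) (v j).

End Free.

(* M has at most D minimal homogeneous generators y, of degrees in [D0, D], and
   the minimal homogeneous relations R between them have degrees at most D. *)
Definition mod_bounded (grB : nat -> B -> Prop) (M : rmodule B)
    (gr : int -> M -> Prop) (D0 D : int) :=
  exists (m : nat) (y : 'I_m -> M) (e : 'I_m -> int)
         (R : free_rmod m -> Prop),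
    [/\ m%:Z <= D,
        injective y /\ minimal_generating (@rsubmod_gen M)
                         (fun _ => True) (range_of y),
        forall j, gr (e j) (y j) /\ D0 <= e j <= D,
        minimal_generating (@rsubmod_gen (free_rmod m))
          (fun v => free_rmod_eval y v = 0) R
      & forall r, R r -> exists2 q : int, free_rmod_gr grB e q r & q <= D].

End RightModules.

(** Enveloping algebras *)

(* The algebra A (x) A^op, with its universal bilinear map, in which
   (a (x) b) (a' (x) b') = a a' (x) b' b. *)
Record enveloping (k : fieldType) (A : algType k) := Enveloping {
  env_alg :> algType k;
  tens : A -> A -> env_alg;
  _ : forall b, linear (tens^~ b);
  _ : forall a, linear (tens a);
  _ : forall (V : lmodType k) (f : A -> A -> V),
        (forall b, linear (f^~ b)) -> (forall a, linear (f a)) ->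
      exists h : env_alg -> V,
        [/\ linear h, forall a b, h (tens a b) = f a b
          & forall h' : env_alg -> V, linear h' ->
              (forall a b, h' (tens a b) = f a b) -> h' =1 h];
  _ : tens 1 1 = 1;
  _ : forall a b a' b', tens a b * tens a' b' = tens (a * a') (b' * b)
}.

Definition env_gr (k : fieldType) (A : algType k) (T : enveloping A)
    (gr : nat -> A -> Prop) (n : nat) : T -> Prop :=
  span (fun t => exists i j a b,
          [/\ (i + j = n)%N, gr i a, gr j b & t = tens T a b]).

(** The sets of Hilbert series of the modules and of the bimodules in E(D0,D) *)

Definition E_module_series (k : fieldType) (D0 D : int) (h : int -> int) :=
  exists (A : algType k) (grA : nat -> A -> Prop)
         (M : rmodule A) (grM : int -> M -> Prop),
    [/\ connected_graded grA /\ alg_bounded grA D,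
        graded_rmodule grA grM,
        mod_bounded grA grM D0 D
      & hilbert_series grM h].

Definition E_bimodule_series (k : fieldType) (D0 D : int) (h : int -> int) :=
  exists (A : algType k) (grA : nat -> A -> Prop) (T : enveloping A)
         (M : rmodule T) (grM : int -> M -> Prop),
    [/\ connected_graded grA /\ alg_bounded grA D,
        graded_rmodule (@env_gr k A T grA) grM,
        mod_bounded (@env_gr k A T grA) grM D0 D
      & hilbert_series grM h].

Definition no_infinite_ascending_chain (P : (int -> int) -> Prop) :=
  ~ exists h : nat -> int -> int,
      (forall n, P (h n)) /\ (forall n, lex_lt (h n) (h n.+1)).

(* Main.v *)
Require Import Defs.
From Stdlib Require Import Classical ClassicalEpsilon FunctionalExtensionality.
From mathcomp Require Import all_boot all_order all_algebra.
From mathcomp Require Import finmap monalg zify.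
Set Implicit Arguments.
Unset Strict Implicit.
Unset Printing Implicit Defensive.
Import Order.TTheory GRing.Theory Num.Theory.
Local Open Scope ring_scope.

(* The component of degree q of a module of E(D_0,D) is a space of words modulo
   the row space of a matrix whose entries are coefficients of the relations of
   A and M; bimodules are right modules over the enveloping algebra, presented
   by x_i (x) 1 and 1 (x) x_i, the relations of A and A^op, and commutators. The
   numerical data being finite, along an ascending chain they may be assumed
   constant, so the n-th member is a point p_n of a fixed affine space. The
   chain stabilizes degree by degree to a limit L. The polynomials vanishing at
   all p_n whose series agrees with L below degree Q form an ideal J_Q,
   increasing with Q, hence constant from some Q on by Hilbert's basis theorem.
   Take p_n agreeing with L below this Q. Its series is lexicographically
   smaller than L, so it drops below L in some degree q, which is detected by a
   nonvanishing minor; but this minor lies in J_(q+1), contained in J_Q. *)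

(** The relations of a member may be any set, so by themselves they offer no coordinates. They are
    replaced by all relations of degree at most a constant: in each degree these form a subspace of
    a fixed finite-dimensional space of words, hence the row space of a square matrix whose size
    does not depend on the member, and the entries of these matrices are the coordinates of [p_n].
    One point then determines the matrices of all degrees [q], by a formula valid over every
    commutative ring; evaluated at the variables of a polynomial ring it yields the minors as
    polynomials. That each degree has finitely many words rests on the positive degrees of the
    generators of [A], which come from minimality. For bimodules the obstacle is the kernel of the
    evaluation of the free algebra on twice as many letters in an enveloping algebra known only by
    its universal property; a linear section of that evaluation shows that the kernel is generated
    in degrees at most twice the common bound for generators and relations of [A]. *)

Section Noetherian.

(** Ideals are predicates because those of the argument are defined by quantifying over the members
    of an infinite chain and come without generators. *)
Definition ring_ideal (R : comNzRingType) (J : R -> Prop) :=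
  [/\ J 0, forall x y, J x -> J y -> J (x + y) & forall a x, J x -> J (a * x)].

Definition noetherian (R : comNzRingType) :=
  forall J : nat -> R -> Prop, (forall n, ring_ideal (J n)) ->
    (forall n x, J n x -> J n.+1 x) -> exists Q, forall q x, J q x -> J Q x.

Lemma ascending_le (T : Type) (J : nat -> T -> Prop) :
  (forall n x, J n x -> J n.+1 x) ->
  forall m n x, (m <= n)%N -> J m x -> J n x.
Proof.
move=> Jup m n x /subnKC <-; elim: (n - m)%N => [|i IHi]; first by rewrite addn0.
by move=> /IHi /Jup; rewrite addnS.
Qed.

Lemma noetherian_field (k : fieldType) : noetherian k.
Proof.
move=> J idJ Jup.
have [[Q [x [JQx x0]]]|J0] := classic (exists Q x, J Q x /\ x != 0).
  exists Q => q y _; have [_ _ JM] := idJ Q.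
  by rewrite -[y](divfK x0); apply: JM.
exists 0%N => q x Jx; have [J00 _ _] := idJ 0%N.
have [-> //|x0] := eqVneq x 0; by case: J0; exists q, x.
Qed.

(* [L q d] is the ideal of coefficients of degree [d] of the elements of
   degree at most [d] of [J q]; it increases in both [q] and [d]. *)
Lemma hilbert_basis (R : comNzRingType) :
  noetherian R -> noetherian {poly R}.
Proof.
move=> noeR J idJ Jup; have Jle := ascending_le Jup.
pose L q d (a : R) := exists f : {poly R}, [/\ J q f, (size f <= d.+1)%N & f`_d = a].
have idL q d : ring_ideal (L q d).
  have [J0 JD JM] := idJ q; split=> [|a b|a b].
  - by exists 0; rewrite size_poly0 coef0.
  - move=> [f [Jf sf <-]] [g [Jg sg <-]]; exists (f + g).
    split; [exact: JD | | by rewrite coefD].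
    by apply: leq_trans (size_polyD _ _) _; rewrite geq_max sf.
  - move=> [f [Jf sf <-]]; exists (a%:P * f).
    split; [exact: JM | | by rewrite coefCM].
    by rewrite mul_polyC; apply: leq_trans (size_scale_leq _ _) _.
have Lq d m n a : (m <= n)%N -> L m d a -> L n d a.
  by move=> mn [f [Jf sf fa]]; exists f; split=> //; apply: Jle Jf.
have Ld q d a : L q d a -> L q d.+1 a.
  move=> [f [Jf sf fa]]; exists (f * 'X); have [_ _ JM] := idJ q; split.
  - by rewrite mulrC; apply: JM.
  - by apply: leq_trans (size_polyMleq _ _) _; rewrite size_polyX addn2.
  - by rewrite coefMX.
(* The diagonal chain [L n n] settles all large degrees at once; the finitely many degrees below its
   index [Q0] of stabilization are treated one at a time. *)
have [Q0 hQ0] : exists Q, forall q a, L q q a -> L Q Q a.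
  by apply: noeR => // n a /Ld; apply: Lq.
have [Q hQ] : exists Q, forall q d a, (d < Q0)%N -> L q d a -> L Q d a.
  elim: Q0 {hQ0} => [|Q0 [Q hQ]]; first by exists 0%N.
  have [|Q' hQ'] := noeR (L^~ Q0) (idL^~ Q0); first by move=> n a; apply: Lq.
  exists (maxn Q Q') => q d a; rewrite ltnS leq_eqVlt => /predU1P[->|dQ0].
    by move/hQ'; apply: Lq; apply: leq_maxr.
  by move/(hQ q d a dQ0); apply: Lq; apply: leq_maxl.
exists (maxn Q Q0) => q f; have [n] := ubnP (size f).
elim: n q f => // n IHn q f sf Jf; have [J0 JD JM] := idJ (maxn Q Q0).
have [->//|f0] := eqVneq f 0; pose d := (size f).-1.
have sfd : size f = d.+1 by rewrite /d prednK // lt0n size_poly_eq0.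
have Lf : L q d f`_d by exists f; rewrite sfd.
have [g [Jg sg gd]] : L (maxn Q Q0) d f`_d.
  case: (ltnP d Q0) => dQ0.
    by move: (hQ q d _ dQ0 Lf); apply: Lq; apply: leq_maxl.
  (* For [Q0 <= d] the coefficient is pushed up to the diagonal, pulled back to degree [Q0] by
     stability, and realized in degree [d] by multiplying with a power of ['X]. *)
  have /(Lq d q (maxn q d))-/(_ (leq_maxl _ _)) L1 := Lf.
  have [g [Jg sg gQ0]] : L Q0 Q0 f`_d.
    apply: (hQ0 (maxn q d)).
    by apply: (ascending_le (Ld _)) L1; apply: leq_maxr.
  exists (g * 'X^(d - Q0)); split.
  - by rewrite mulrC; apply: JM; apply: Jle Jg; apply: leq_maxr.
  - apply: leq_trans (size_polyMleq _ _) _; rewrite size_polyXn addnS /=.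
    by rewrite -(subnKC dQ0) addKn -addSn leq_add2r.
  - by rewrite coefMXn ltnNge leq_subr /= subKn.
(* Subtracting [g] cancels the leading term, but [f - g] is known to lie in [J] only at the larger
   of the two indices, so the induction on the size has to allow every [q]. *)
rewrite -[f](subrK g) addrC; apply: JD => //; apply: (IHn (maxn q (maxn Q Q0))).
  rewrite -ltnS; apply: leq_trans sf; rewrite ltnS sfd ltnS.
  apply/leq_sizeP => j; rewrite leq_eqVlt coefB => /predU1P[<-|dj].
    by rewrite gd subrr.
  by rewrite !nth_default ?subrr ?sfd //; apply: leq_trans sg _.
have [_ JD' JM'] := idJ (maxn q (maxn Q Q0)).
apply: JD'; first by apply: Jle Jf; apply: leq_maxl.
by rewrite -mulN1r; apply: JM'; apply: Jle Jg; apply: leq_maxr.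
Qed.

(** [P] is an iterated polynomial ring and [X] its tuple of variables. The outermost variable has
    index [ord0], and Horner evaluation at [p ord0] extends a specialization of the others. *)
Lemma noetherian_generic_point_ord (k : fieldType) (n : nat) :
  exists (P : comNzRingType) (X : 'I_n -> P), noetherian P /\
    forall p : 'I_n -> k, exists f : {rmorphism P -> k}, forall i, f (X i) = p i.
Proof.
elim: n => [|n [P [X [noeP evP]]]].
  exists k, (fun=> 0); split=> [|p]; first exact: noetherian_field.
  by exists idfun; case.
exists {poly P}, (fun i => if unlift ord0 i is Some j then (X j)%:P else 'X).
split=> [|p]; first exact: hilbert_basis.
have [f fX] := evP (fun i => p (lift ord0 i)).
exists (horner_morph (fun a => mulrC (p ord0) (f a))) => i.
case: unliftP => [j|] ->; first by rewrite /= horner_morphC fX.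
by rewrite /= horner_morphX.
Qed.

Lemma noetherian_generic_point (k : fieldType) (I : finType) :
  exists (P : comNzRingType) (X : I -> P), noetherian P /\
    forall p : I -> k, exists f : {rmorphism P -> k}, forall i, f (X i) = p i.
Proof.
have [P [X [noeP evP]]] := noetherian_generic_point_ord k #|I|.
exists P, (X \o enum_rank); split=> // p.
have [f fX] := evP (p \o enum_val); exists f => i.
by rewrite /= fX /= enum_rankK.
Qed.

End Noetherian.

(** * Lexicographic chains and minors *)

Section Chains.

Definition lex_ltn_at q (a b : nat -> nat) :=
  (forall i, (i < q)%N -> a i = b i) /\ (a q < b q)%N.

Lemma lex_ltn_at_trans q r a b c :
  lex_ltn_at q a b -> lex_ltn_at r b c -> lex_ltn_at (minn q r) a c.
Proof.
move=> [ab abq] [bc bcr]; split=> [i|].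
  by rewrite leq_min => /andP[iq ir]; rewrite ab ?bc.
by case: (ltngtP q r) => [qr|rq|qr];
  [rewrite -bc | rewrite ab | move: abq bcr; rewrite qr; apply: ltn_trans].
Qed.

(** Each strict increase uses up a unit of the room [c] left below the bound [b]. *)
Lemma nondecreasing_bounded_stable (u : nat -> nat) n0 b :
  (forall n, (n0 <= n)%N -> (u n <= u n.+1)%N) -> (forall n, (u n <= b)%N) ->
  exists2 n1, (n0 <= n1)%N & forall n, (n1 <= n)%N -> u n = u n1.
Proof.
move=> u_nd u_le.
have u_mono m n : (n0 <= m)%N -> (m <= n)%N -> (u m <= u n)%N.
  move=> n0m /subnKC <-; elim: (n - m)%N => [|i IHi]; first by rewrite addn0.
  by rewrite addnS; apply: leq_trans IHi (u_nd _ _); apply: leq_trans n0m (leq_addr _ _).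
suff H c n1 : (n0 <= n1)%N -> (b <= u n1 + c)%N ->
    exists2 n2, (n0 <= n2)%N & forall n, (n2 <= n)%N -> u n = u n2.
  by apply: (H b n0) => //; apply: leq_addl.
elim: c n1 => [|c IHc] n1 n01 bc.
  exists n1 => // n n1n; apply/eqP; rewrite eqn_leq [X in _ && X]u_mono // andbT.
  by apply: leq_trans (u_le n) _; rewrite addn0 in bc.
have [[n [n1n un]]|noinc] := classic (exists n, (n1 <= n)%N /\ u n != u n1).
  apply: (IHc n); first exact: leq_trans n1n.
  have : (u n1 < u n)%N by rewrite ltn_neqAle eq_sym un; apply: u_mono.
  by move: bc; lia.
exists n1 => // n n1n; apply/eqP/negP => /negP un.
by case: noinc; exists n.
Qed.

Lemma lex_chain_limit (g : nat -> nat -> nat) b :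
  (forall n, exists q, lex_ltn_at q (g n) (g n.+1)) ->
  (forall n i, (g n i <= b i)%N) ->
  exists L : nat -> nat,
    (forall Q, exists n, forall i, (i < Q)%N -> g n i = L i) /\
    (forall n, exists q, (g n q < L q)%N).
Proof.
move=> g_lt g_le.
have stable Q : exists n0, forall n i, (n0 <= n)%N -> (i < Q)%N -> g n i = g n0 i.
  elim: Q => [|Q [n0 st]]; first by exists 0%N.
  have [n n0n|//|n1 n01 st1] := @nondecreasing_bounded_stable (g ^~ Q) n0 (b Q).
    have [q [eq_q lt_q]] := g_lt n; case: (ltngtP q Q) lt_q => [qQ|Qq|-> /ltnW//].
      by rewrite (st n.+1 q) ?leqW // (st n q) // ltnn.
    by rewrite (eq_q Q).
  exists n1 => n i n1n; rewrite ltnS leq_eqVlt => /predU1P[->|iQ]; first exact: st1.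
  by rewrite (st n) ?(st n1) //; apply: leq_trans n1n.
have [N hN] := choice _ stable.
pose L i := g (N i.+1) i.
have stL Q : exists n0, forall n i, (n0 <= n)%N -> (i < Q)%N -> g n i = L i.
  have [n0 st] := stable Q; exists n0 => n i n0n iQ; rewrite (st n) //.
  by rewrite -(st (maxn n0 (N i.+1))) ?leq_maxl // (hN i.+1) ?leq_maxr.
exists L; split=> [Q|n].
  by have [n0 st] := stL Q; exists n0 => i; apply: st.
have [q ltq] := g_lt n; have [n0 st] := stL q.+1.
(* Composing with later steps can only lower the first place of difference, so it stays at most [q],
   where a late member has already reached [L]. *)
have [r rq [_ ltr]] : exists2 r, (r <= q)%N & lex_ltn_at r (g n) (g (n.+1 + n0)%N).
  elim: {st}n0 => [|m [r rq lt_r]]; first by exists q; rewrite ?addn0.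
  have [s lt_s] := g_lt (n.+1 + m)%N; rewrite addnS.
  exists (minn r s); last exact: lex_ltn_at_trans lt_s.
  by apply: leq_trans (geq_minl _ _) rq.
by exists r; rewrite -(st (n.+1 + n0)%N) ?leq_addl.
Qed.

(** The rank is witnessed by a determinant, which, unlike the rank itself, is polynomial in the
    entries and commutes with specialization. *)
Lemma mxrank_mxsub_unitmx (k : fieldType) m n (A : 'M[k]_(m, n)) :
  exists (f : 'I_(\rank A) -> 'I_m) (g : 'I_(\rank A) -> 'I_n),
    mxsub f g A \in unitmx.
Proof.
have [f f_free] : exists f : 'I_(\rank A) -> 'I_m, row_free (rowsub f A).
  by exists (maxrankfun A); apply: maxrowsub_free.
have Bfull : row_full (rowsub f A)^T by rewrite /row_full mxrank_tr.
exists f, (fullrankfun Bfull); rewrite -unitmx_tr.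
have := fullrowsub_unit Bfull; congr (_ \in unitmx).
by apply/matrixP=> i j; rewrite !mxE.
Qed.

Lemma det_mxsub_neq0_rank (k : fieldType) m n r (A : 'M[k]_(m, n))
    (f : 'I_r -> 'I_m) (g : 'I_r -> 'I_n) :
  \det (mxsub f g A) != 0 -> (r <= \rank A)%N.
Proof.
rewrite -unitfE -unitmxE => /mxrank_unit <-; rewrite mxsubrc.
apply: leq_trans (mxrankS (rowsub_sub _ _)) _.
by rewrite -mxrank_tr trmx_mxsub -(mxrank_tr A); apply/mxrankS/rowsub_sub.
Qed.

(** Naturality of [Mat] lets the matrix at the generic point [X] specialize to the matrix at every
    [p n]; its minors are the elements of [P] to which the chain condition applies. *)
Lemma no_lex_chain_of_coranks (k : fieldType) (I : finType) (r c : nat -> nat)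
    (Mat : forall R : comNzRingType, (I -> R) -> forall q, 'M[R]_(r q, c q))
    (p : nat -> I -> k) (g : nat -> nat -> nat) :
  (forall (R S : comNzRingType) (f : {rmorphism R -> S}) (x : I -> R) q,
     map_mx f (Mat R x q) = Mat S (f \o x) q) ->
  (forall n q, g n q = c q - \rank (Mat k (p n) q))%N ->
  ~ forall n, exists q, lex_ltn_at q (g n) (g n.+1).
Proof.
move=> Mat_nat gE g_lt.
have [L [approx below]] : exists L : nat -> nat,
    (forall Q, exists n, forall i, (i < Q)%N -> g n i = L i) /\
    (forall n, exists q, (g n q < L q)%N).
  by apply: (lex_chain_limit (b := c)) => // n i; rewrite gE leq_subr.
have [P [X [noeP evP]]] := noetherian_generic_point k I.
have [theta thetaX] := choice _ (fun n => evP (p n)).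
pose J Q F := forall n, (forall i, (i < Q)%N -> g n i = L i) -> theta n F = 0.
have [||Q JQ] := noeP J.
- move=> Q; split=> [n _|F G JF JG n gL|a F JF n gL]; first exact: rmorph0.
    by rewrite rmorphD JF ?JG ?addr0.
  by rewrite rmorphM JF ?mulr0.
- by move=> Q F JF n gL; apply: JF => i iQ; apply: gL; apply: ltnW.
have [n gL] := approx Q; have [q gq] := below n.
have [f [h minor]] := mxrank_mxsub_unitmx (Mat k (p n) q).
pose F := \det (mxsub f h (Mat P X q)).
have thetaF n' : theta n' F = \det (mxsub f h (Mat k (p n') q)).
  rewrite -det_map_mx map_mxsub Mat_nat; congr (\det (mxsub f h _)).
  by congr (Mat k _ q); apply: functional_extensionality => i; apply: thetaX.
(* A member agreeing with [L] up to degree [q] has there a larger corank than member [n], hence a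
   smaller rank, so its minor of size the rank of member [n] vanishes. *)
have JF : J q.+1 F.
  move=> n' gL'; rewrite thetaF; apply/eqP/negP => /negP /det_mxsub_neq0_rank rk.
  move: gq; rewrite -(gL' q) // !gE ltnNge => /negP; apply.
  exact: leq_sub2l.
move: minor; rewrite unitmxE unitfE -thetaF => /eqP; apply.
exact: JQ JF n gL.
Qed.
End Chains.

(** * Subspaces, coranks and gradings *)

Section LinearAlgebra.
Variables (k : fieldType).

Section Subspace.
Variables (V : lmodType k) (S : V -> Prop).
Hypothesis subS : subspace S.

Lemma subspace0 : S 0. Proof. by case: subS. Qed.

Lemma subspaceZD c u v : S u -> S v -> S (c *: u + v).
Proof. by case: subS => _; apply. Qed.

Lemma subspaceD u v : S u -> S v -> S (u + v).
Proof. by move=> Su Sv; rewrite -[u]scale1r; apply: subspaceZD. Qed.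

Lemma subspaceZ c u : S u -> S (c *: u).
Proof. by move=> Su; rewrite -[_ *: _]addr0; apply/subspaceZD/subspace0. Qed.

Lemma subspaceB u v : S u -> S v -> S (u - v).
Proof. by move=> Su Sv; rewrite addrC -scaleN1r; apply: subspaceZD. Qed.

Lemma subspace_sum (I : Type) (s : seq I) (P : pred I) (F : I -> V) :
  (forall i, P i -> S (F i)) -> S (\sum_(i <- s | P i) F i).
Proof.
by move=> SF; apply: big_ind => //; [apply: subspace0 | apply: subspaceD].
Qed.

End Subspace.

Lemma span_subspace (V : lmodType k) (X : V -> Prop) : subspace (Defs.span X).
Proof.
split=> [S subS _|c u v Xu Xv S subS XS]; first exact: subspace0.
by apply: subspaceZD => //; [apply: Xu | apply: Xv].
Qed.

Lemma span_incl (V : lmodType k) (X : V -> Prop) : subpredp X (Defs.span X).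
Proof. by move=> v Xv S _; apply. Qed.

Lemma linear_fun0 (V W : lmodType k) (f : V -> W) : linear f -> f 0 = 0.
Proof.
by move=> lin_f; have := lin_f (-1) 0 0; rewrite !scaleN1r oppr0 addr0 addNr.
Qed.

Lemma linear_eq_subspace (V W : lmodType k) (h h' : V -> W) :
  linear h -> linear h' -> subspace (fun v => h v = h' v).
Proof.
move=> lin_h lin_h'; split=> [|c u v hu hv]; first by rewrite !linear_fun0.
by rewrite lin_h lin_h' hu hv.
Qed.

Lemma preim_subspace (V W : lmodType k) (f : V -> W) (S : W -> Prop) :
  linear f -> subspace S -> subspace (fun v => S (f v)).
Proof.
move=> lin_f subS; split=> [|c u v Su Sv].
  by rewrite linear_fun0 //; apply: subspace0.
by rewrite lin_f; apply: subspaceZD.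
Qed.

(** Vectors of [S] outside the row space are adjoined one at a time; [c] bounds the remaining
    corank, which drops at each step. *)
Lemma subspace_rowspace n (S : 'rV[k]_n -> Prop) :
  subspace S -> exists A : 'M[k]_n, forall u, S u <-> (u <= A)%MS.
Proof.
move=> subS.
suff H c (A : 'M[k]_n) : (n - \rank A <= c)%N ->
    (forall u : 'rV_n, (u <= A)%MS -> S u) ->
    exists A : 'M[k]_n, forall u, S u <-> (u <= A)%MS.
  apply: (H n 0) => [|u /submx0null->]; first exact: leq_subr.
  exact: subspace0.
elim: c A => [|c IHc] A rA AS.
  exists A => u; split=> [_|]; last exact: AS.
  by apply: submx_full; rewrite /row_full eqn_leq rank_leq_col /=; move: rA; lia.
have [[u [Su uA]]|noext] := classic (exists u, S u /\ ~~ (u <= A)%MS).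
  apply: (IHc (A + u)%MS) => [|v].
    have : (\rank A < \rank (A + u)%MS)%N.
      rewrite ltn_neqAle mxrankS ?addsmxSl // andbT.
      apply: contra uA; rewrite (mxrank_leqif_sup (addsmxSl A u)).
      by rewrite addsmx_sub => /andP[].
    by move: rA; lia.
  case/sub_addsmxP => [[a b] /= ->]; apply: subspaceD => //.
    by apply: AS; apply: submxMl.
  by rewrite [b]mx11_scalar mul_scalar_mx; apply: subspaceZ.
exists A => u; split=> [Su|]; last exact: AS.
by apply/negPn/negP => uA; case: noext; exists u.
Qed.

(** Coordinates in a basis of [S] turn the spanning family [b] into a matrix of rank [n] whose left
    kernel is the row space of [A]. *)
Lemma has_dim_corank (V : lmodType k) (S : V -> Prop) n r c (b : 'I_c -> V)
    (A : 'M[k]_(r, c)) :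
  has_dim S n ->
  (forall v, S v <-> exists u : 'rV_c, v = \sum_i u 0 i *: b i) ->
  (forall u : 'rV_c, \sum_i u 0 i *: b i = 0 <-> (u <= A)%MS) ->
  n = (c - \rank A)%N.
Proof.
move=> [b' [b'S b'free]] bS relA.
have [Phi PhiE] : exists Phi : 'I_c -> 'I_n -> k,
    forall i, b i = \sum_j Phi i j *: b' j.
  apply: (choice (fun i f => b i = \sum_j f j *: b' j)) => i; apply/b'S/bS.
  exists (delta_mx 0 i); rewrite (bigD1 i) //= mxE !eqxx scale1r big1 ?addr0 //.
  by move=> j ji; rewrite mxE (negPf ji) andbF scale0r.
pose M := \matrix_(i, j) Phi i j.
have bM (u : 'rV_c) : \sum_i u 0 i *: b i = \sum_j (u *m M) 0 j *: b' j.
  under eq_bigr do rewrite PhiE scaler_sumr.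
  rewrite exchange_big; apply: eq_bigr => j _.
  rewrite mxE scaler_suml; apply: eq_bigr => i _; by rewrite mxE scalerA.
have rM : \rank M = n.
  apply/eqP; rewrite -[_ == n]/(row_full M) -sub1mx; apply/row_subP => j.
  have /bS[u uE] : S (b' j).
    apply/b'S; exists (fun j' => (j' == j)%:R).
    rewrite (bigD1 j) //= eqxx scale1r big1 ?addr0 //.
    by move=> j' /negPf ->; rewrite scale0r.
  suff -> : row j 1%:M = u *m M by apply: submxMl.
  apply/rowP => j'; apply/eqP; rewrite -subr_eq0; apply/eqP.
  move: j'; apply: (b'free (fun j' => (row j 1%:M) 0 j' - (u *m M) 0 j')).
  under eq_bigr do rewrite scalerBl.
  rewrite sumrB -bM -uE (bigD1 j) //= !mxE eqxx scale1r big1 ?addr0 ?subrr //.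
  by move=> j' /negPf; rewrite !mxE eq_sym => ->; rewrite scale0r.
have -> : \rank A = \rank (kermx M).
  apply: eqmx_rank; apply/rV_eqP => u; rewrite (sameP sub_kermxP eqP).
  apply/idP/eqP => [/relA|uM].
    rewrite bM => /b'free u0; apply/rowP=> j; by rewrite u0 mxE.
  by apply/relA; rewrite bM uM big1 // => j _; rewrite mxE scale0r.
by rewrite mxrank_ker rM subKn // -rM rank_leq_row.
Qed.

(* Homogeneous elements decompose homogeneously: the components of the wrong
   degree cancel. *)
Lemma grading_sum_homog (I : eqType) (V : lmodType k) (gr : I -> V -> Prop)
    (T : eqType) (s : seq T) (F : T -> V) (dF : T -> I) i :
  grading gr -> (forall t, gr (dF t) (F t)) -> gr i (\sum_(t <- s) F t) ->
  \sum_(t <- s) F t = \sum_(t <- s | dF t == i) F t.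
Proof.
move=> [gr_sub _ gr_free] grF grv.
pose G j := \sum_(t <- s | dF t == j) F t - (if j == i then \sum_(t <- s) F t else 0).
pose l := undup (i :: map dF s).
have il : i \in l by rewrite mem_undup mem_head.
have grG j : gr j (G j).
  apply: subspaceB => //; first by apply: subspace_sum => // t /eqP <-.
  by case: eqP => [->//|_]; apply: subspace0.
have sumG : \sum_(j <- l) G j = 0.
  rewrite sumrB [X in _ - X](bigD1_seq i) ?undup_uniq //= eqxx.
  rewrite [X in _ - (_ + X)]big1 => [|j /negPf -> //]; rewrite addr0.
  apply/eqP; rewrite subr_eq0; apply/eqP.
  rewrite (exchange_big_dep predT) //= big_seq [RHS]big_seq; apply: eq_bigr => t ts.
  rewrite big_mkcond (bigD1_seq (dF t)) ?undup_uniq //=; last first.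
    by rewrite mem_undup inE map_f ?orbT.
  by rewrite eqxx big1 ?addr0 // => j /negPf; rewrite eq_sym => ->.
have := gr_free l G (undup_uniq _) grG sumG i il.
by rewrite /G eqxx => /eqP; rewrite subr_eq0 => /eqP.
Qed.

End LinearAlgebra.

(** * The free algebra and evaluation of its elements *)

Section FreeAlgebra.
Variables (k : fieldType) (N : nat).
Notation F := (free_alg k N).
Implicit Types (s t : seq 'I_N) (f g : F).

Definition mon s : F := << FMonom s >>.

Lemma mon_nil : mon [::] = 1.
Proof. by congr (<< _ >>); apply/eqP; rewrite fmP fm1. Qed.

Lemma mon_cat s t : mon (s ++ t) = mon s * mon t.
Proof.
have := fgmulUU (1 : k) 1 (FMonom s) (FMonom t); rewrite mul1r => /esym fgE.
apply: etrans fgE; congr (<< _ >>); by apply/eqP; rewrite fmP fmM.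
Qed.

Lemma mcoeff_mon s t : mcoeff (FMonom s) (mon t) = (t == s)%:R.
Proof. by rewrite mcoeffU1 fmP. Qed.

Lemma mcoeff_scale c (w : {fmonom 'I_N}) f : mcoeff w (c *: f) = c * mcoeff w f.
Proof. exact: mcoeffZ. Qed.

Lemma scale_mon c s : c *: mon s = << c *g FMonom s >>.
Proof.
apply/malgP => w.
rewrite [RHS](mcoeffU (FMonom s) c w) mcoeff_scale.
by rewrite /mon (mcoeffU (FMonom s) 1 w) mulrnAr mulr1.
Qed.

Lemma mcoeff_linear (w : {fmonom 'I_N}) : linear (fun f : F => mcoeff w f : k^o).
Proof. by move=> c f g; rewrite mcoeffD mcoeff_scale. Qed.

Lemma free_algE f : f = \sum_(w <- msupp f) mcoeff w f *: mon w.
Proof.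
by rewrite {1}[f]monalgE; apply: eq_bigr => w _; rewrite scale_mon fmK.
Qed.

Lemma free_alg_ind_supp (S : F -> Prop) f :
  subspace S -> (forall s, FMonom s \in msupp f -> S (mon s)) -> S f.
Proof.
move=> subS Smon; rewrite [f]free_algE big_seq; apply: subspace_sum => // w wf.
by apply: subspaceZ => //; apply: Smon; rewrite fmK.
Qed.

Lemma free_alg_ind (S : F -> Prop) f :
  subspace S -> (forall s, S (mon s)) -> S f.
Proof. by move=> subS Smon; apply: free_alg_ind_supp. Qed.

Lemma linear_ext_mon (V : lmodType k) (h h' : F -> V) :
  linear h -> linear h' -> (forall s, h (mon s) = h' (mon s)) -> h =1 h'.
Proof.
move=> lin_h lin_h' hh' f; apply: (free_alg_ind (S := fun f => h f = h' f)) => //.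
exact: linear_eq_subspace.
Qed.

(** The [lalgType] axiom moves scalars through the left factor. For the right factor the identity is
    checked on words, after reducing to them first in [f], then in [g]. *)
Lemma free_mulr_linear f : linear (fun g => f * g).
Proof.
suff scaleAr c g : f * (c *: g) = c *: (f * g).
  by move=> c g h; rewrite mulrDr scaleAr.
apply: (free_alg_ind (S := fun f => f * (c *: g) = c *: (f * g))).
  split=> [|a u v hu hv]; first by rewrite !mul0r scaler0.
  by rewrite !mulrDl -!scalerAl hu hv scalerDr !scalerA mulrC.
move=> s; move: c.
apply: (free_alg_ind (S := fun g => forall c, mon s * (c *: g) = c *: (mon s * g))).
  split=> [c|a u v hu hv c]; first by rewrite scaler0 !mulr0 scaler0.
  rewrite scalerDr scalerA !mulrDr.
  apply: etrans (congr2 +%R (hu (c * a)) (hv c)) _.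
  apply/esym/(etrans (congr1 (fun y => c *: (y + _)) (hu a))).
  by rewrite scalerDr scalerA.
move=> t c; rewrite -mon_cat !scale_mon.
have := fgmulUU (1 : k) c (FMonom s) (FMonom t); rewrite mul1r => fgE.
apply: (etrans fgE); congr (<< _ *g _ >>).
by apply/eqP; rewrite fmP fmM.
Qed.

Lemma free_mull_linear g : linear (fun f => f * g).
Proof. by move=> c f h; rewrite mulrDl scalerAl. Qed.

(** The linear extension of a map given on the basis of words. [free_eval] is the instance at
    [word_eval], so it inherits linearity by conversion. *)
Definition mon_ext (V : lmodType k) (v : seq 'I_N -> V) (f : F) : V :=
  \sum_(w <- msupp f) mcoeff w f *: v w.

Lemma mon_extEw (V : lmodType k) (v : seq 'I_N -> V) (D : {fset {fmonom 'I_N}}) f :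
  (msupp f `<=` D)%fset -> mon_ext v f = \sum_(w <- D) mcoeff w f *: v w.
Proof.
move=> le; rewrite [LHS](big_fset_incl _ le) => //= w _ /mcoeff_outdom ->.
by rewrite scale0r.
Qed.

Lemma mon_ext_linear (V : lmodType k) (v : seq 'I_N -> V) : linear (mon_ext v).
Proof.
move=> c f g; pose D := (msupp (c *: f + g) `|` (msupp f `|` msupp g))%fset.
rewrite (@mon_extEw _ v D (c *: f + g)) ?fsubsetUl //.
rewrite (@mon_extEw _ v D f); last by rewrite /D fsetUCA fsubsetUl.
rewrite (@mon_extEw _ v D g); last by rewrite /D fsetUA fsubsetUr.
rewrite scaler_sumr -big_split; apply: eq_bigr => w _.
by rewrite mcoeffD mcoeff_scale scalerDl scalerA.
Qed.

Lemma mon_ext_mon (V : lmodType k) (v : seq 'I_N -> V) s : mon_ext v (mon s) = v s.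
Proof.
rewrite (@mon_extEw _ v [fset FMonom s]%fset) ?msuppU_le //.
by rewrite big_seq_fset1 mcoeffUU scale1r.
Qed.

Section Eval.
Variables (A : algType k) (x : 'I_N -> A).

Definition word_eval s := \prod_(i <- s) x i.

Lemma word_eval_cat s t : word_eval (s ++ t) = word_eval s * word_eval t.
Proof. exact: big_cat. Qed.

Lemma free_eval_linear : linear (free_eval x).
Proof. exact: (mon_ext_linear word_eval). Qed.

Lemma free_eval_mon s : free_eval x (mon s) = word_eval s.
Proof. exact: (mon_ext_mon word_eval). Qed.

Lemma free_evalM f g : free_eval x (f * g) = free_eval x f * free_eval x g.
Proof.
have lin := free_eval_linear.
apply: (linear_ext_mon (h := fun g => free_eval x (f * g))
                       (h' := fun g => free_eval x f * free_eval x g)).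
- by move=> c u v; rewrite free_mulr_linear lin.
- by move=> c u v; rewrite lin mulrDr scalerAr.
move=> t; apply: (linear_ext_mon (h := fun f => free_eval x (f * mon t))
                       (h' := fun f => free_eval x f * free_eval x (mon t))).
- by move=> c u v; rewrite free_mull_linear lin.
- by move=> c u v; rewrite lin mulrDl scalerAl.
by move=> s; rewrite -mon_cat !free_eval_mon word_eval_cat.
Qed.

Lemma free_evalB f g : free_eval x (f - g) = free_eval x f - free_eval x g.
Proof.
have -> : f - g = (-1 : k) *: g + f by rewrite scaleN1r addrC.
by rewrite free_eval_linear scaleN1r addrC.
Qed.

Lemma free_eval1 : free_eval x 1 = 1.
Proof. by rewrite -mon_nil free_eval_mon /word_eval big_nil. Qed.

Lemma free_eval0 : free_eval x 0 = 0.
Proof. exact: linear_fun0 free_eval_linear. Qed.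

End Eval.
End FreeAlgebra.

Lemma linear_lincomb (k : fieldType) (V W : lmodType k) (h : V -> W) (I : Type)
    (s : seq I) (P : pred I) (c : I -> k) (F : I -> V) :
  linear h -> h (\sum_(i <- s | P i) c i *: F i) = \sum_(i <- s | P i) c i *: h (F i).
Proof.
move=> lin_h; have h0 := linear_fun0 lin_h.
apply: (big_rec2 (fun x y => h x = y)) => // i x y _ <-.
by rewrite lin_h.
Qed.

(** The rows are indexed by [T] itself, redundant rows being allowed, so that the shape of the table
    does not depend on the number of relations. Coordinates outside [P] are unconstrained. *)
Lemma relation_matrix (k : fieldType) (V : lmodType k) (T : finType)
    (P : pred T) (b : T -> V) :
  exists A : T -> T -> k, (forall i, \sum_(u | P u) A i u *: b u = 0) /\
    forall c : T -> k, \sum_(u | P u) c u *: b u = 0 ->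
      exists a : T -> k, forall u, P u -> c u = \sum_i a i * A i u.
Proof.
pose S (v : 'rV[k]_#|T|) := \sum_(u | P u) v 0 (enum_rank u) *: b u = 0.
have subS : subspace S.
  split=> [|c u v Su Sv]; first by apply: big1 => u _; rewrite mxE scale0r.
  rewrite /S; under eq_bigr do rewrite !mxE scalerDl -scalerA.
  by rewrite big_split -scaler_sumr /= Su Sv scaler0 addr0.
have [A AE] := subspace_rowspace subS.
exists (fun i u => A (enum_rank i) (enum_rank u)); split=> [i|c c0].
  have /AE Si : (row (enum_rank i) A <= A)%MS by apply: row_sub.
  by rewrite -[RHS]Si; apply: eq_bigr => u _; rewrite mxE.
have /AE/submxP[a aE] : S (\row_u c (enum_val u)).
  by rewrite /S -[RHS]c0; apply: eq_bigr => u _; rewrite mxE enum_rankK.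
exists (fun i => a 0 (enum_rank i)) => u _.
have := congr1 (fun v : 'rV_#|T| => v 0 (enum_rank u)) aE.
rewrite !mxE enum_rankK => ->.
by rewrite (reindex _ (onW_bij _ (@enum_rank_bij T))).
Qed.

Section RactTheory.
Variables (k : fieldType) (B : algType k) (M : rmodule B).

Lemma ract_linl b : linear ((@ract k B M)^~ b). Proof. by case: M. Qed.
Lemma ract_linr v : linear (@ract k B M v). Proof. by case: M v. Qed.
Lemma ract1 (v : M) : ract v 1 = v. Proof. by case: M v. Qed.
Lemma ractM (v : M) a b : ract v (a * b) = ract (ract v a) b.
Proof. by case: M v. Qed.

End RactTheory.

(** * The free right module over the free algebra *)

Section FreeModule.
Variables (k : fieldType) (N m : nat).
Notation F := (free_alg k N).
Notation FM := {ffun 'I_m -> F}.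

Lemma ffunZD (V : lmodType k) (c : k) (P Q : {ffun 'I_m -> V}) j :
  (c *: P + Q) j = c *: P j + Q j.
Proof. by rewrite !ffunE. Qed.

Definition bvec (j : 'I_m) (f : F) : FM := [ffun j' => if j' == j then f else 0].

Definition fm_act (P : FM) (f : F) : FM := [ffun j => P j * f].

Lemma fm_actE P f j : fm_act P f j = P j * f.
Proof. by rewrite ffunE. Qed.

Lemma bvec_linear j : linear (bvec j).
Proof.
move=> c f g; apply/ffunP => j'; rewrite !ffunE.
by case: eqP => // _; rewrite scaler0 addr0.
Qed.

Lemma fm_act_linl f : linear (fm_act^~ f).
Proof.
move=> c P Q; apply/ffunP => j; apply: etrans (fm_actE _ _ _) _.
apply: etrans (congr1 (fun g => g * f) (ffunZD c P Q j)) _.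
apply: etrans (free_mull_linear f c (P j) (Q j)) _.
apply: etrans _ (esym (ffunZD _ _ _ _)).
by apply: congr2; [apply: congr1; apply/esym/fm_actE | apply/esym/fm_actE].
Qed.

Lemma fm_act_linr P : linear (fm_act P).
Proof.
move=> c f g; apply/ffunP => j; apply: etrans (fm_actE _ _ _) _.
apply: etrans (free_mulr_linear (P j) c f g) _.
apply: etrans _ (esym (ffunZD _ _ _ _)).
by apply: congr2; [apply: congr1; apply/esym/fm_actE | apply/esym/fm_actE].
Qed.

Lemma fm_act_bvec j f g : fm_act (bvec j f) g = bvec j (f * g).
Proof.
by apply/ffunP => j'; rewrite !ffunE; case: eqP => // _; rewrite mul0r.
Qed.

Lemma bvec_sum (P : FM) : P = \sum_j bvec j (P j).
Proof.
apply/ffunP => j; rewrite sum_ffunE (bigD1 j) //= ffunE eqxx big1 ?addr0 //.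
by move=> j' j'j; rewrite ffunE eq_sym (negPf j'j).
Qed.

Lemma fm_decomp (P : FM) : exists (l : seq ('I_m * {fmonom 'I_N})) (c : _ -> k),
  P = \sum_(x <- l) c x *: bvec x.1 (mon k x.2) /\
  forall x, x \in l -> x.2 \in msupp (P x.1).
Proof.
exists [seq (j, w) | j <- enum 'I_m, w <- enum_fset (msupp (P j))].
exists (fun x => mcoeff x.2 (P x.1)); split; last first.
  by move=> x /allpairsPdep[j [w [_ ws ->]]].
rewrite big_allpairs_dep {1}[P]bvec_sum big_enum; apply: eq_bigr => j _.
by rewrite {1}[P j]free_algE (linear_lincomb _ _ _ _ (@bvec_linear j)).
Qed.

Lemma fm_ind_supp (S : FM -> Prop) (P : FM) : subspace S ->
  (forall j s, FMonom s \in msupp (P j) -> S (bvec j (mon k s))) -> S P.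
Proof.
move=> subS Sb; have [l [c [PE lP]]] := fm_decomp P.
rewrite PE big_seq; apply: subspace_sum => // x xl.
by apply: subspaceZ => //; apply: Sb; rewrite fmK; apply: lP.
Qed.

End FreeModule.

Section Homogeneous.
Variables (k : fieldType) (N : nat) (d : 'I_N -> nat).
Notation F := (free_alg k N).

Definition wdeg (s : seq 'I_N) := (\sum_(i <- s) d i)%N.

Lemma wdeg_cat s t : wdeg (s ++ t) = (wdeg s + wdeg t)%N.
Proof. exact: big_cat. Qed.

Lemma size_le_wdeg s : (forall i, 0 < d i)%N -> (size s <= wdeg s)%N.
Proof.
move=> gen_deg_gt0; rewrite -sum1_size; apply: leq_sum => i _; exact: gen_deg_gt0.
Qed.

Lemma free_homog_subspace q : subspace (@free_homog k N d q).
Proof.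
split=> [w|c f g hf hg w]; first by rewrite msupp0.
move=> /(fsubsetP (msuppD_le _ _)); rewrite in_fsetU => /orP[|]; last exact: hg.
by move=> /(fsubsetP (msuppZ_le _ _)); apply: hf.
Qed.

Lemma free_homog_mon s : free_homog d (wdeg s) (mon k s).
Proof. by move=> w; rewrite msuppU1 in_fset1 => /eqP ->. Qed.

Lemma free_homogM q r (f g : F) :
  free_homog d q f -> free_homog d r g -> free_homog d (q + r) (f * g).
Proof.
move=> hf hg.
apply: (free_alg_ind_supp (S := fun f => free_homog d (q + r) (f * g))) => [|s sf].
  by apply: preim_subspace (free_homog_subspace _); apply: free_mull_linear.
apply: (free_alg_ind_supp (S := fun g => free_homog d (q + r) (mon k s * g))) => [|t tg].
  by apply: preim_subspace (free_homog_subspace _); apply: free_mulr_linear.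
rewrite -mon_cat -(hf _ sf) -(hg _ tg) -[(_ + _)%N]wdeg_cat.
exact: free_homog_mon.
Qed.

End Homogeneous.

(** * The matrix of relations in a given degree *)

Section RelationMatrix.
Variables (D0 : int) (C N m : nat) (d : 'I_N -> nat) (e : 'I_m -> int).

Definition tdeg (x : 'I_m * seq 'I_N) : int := e x.1 + (wdeg d x.2)%:Z.

(** A bound for the length of [w] when [y_j w] has degree [q]: the letters have positive degrees and
    [y_j] has degree at least [D0]. For [q < D0] there is no such word. *)
Definition maxlen (q : int) := `|q - D0|%N.

(* Coefficients of the relations: [inl (t, i, u)] is the coefficient of the
   word [u] in the [i]-th algebra relation of degree [t], [inr (t, i, (j, u))]
   that of [y_j u] in the [i]-th module relation of degree [D0 + t].  *)
Definition relcoef : finType :=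
  (('I_C.+1 * C.-bseq 'I_N * C.-bseq 'I_N) +
   ('I_C.+1 * ('I_m * C.-bseq 'I_N) * ('I_m * C.-bseq 'I_N)))%type.

(** The indices are not restricted to multiples of degree [q]: a row of another degree is zero, as
    it meets no basis word. *)
Definition rel_index q : finType :=
  (('I_C.+1 * C.-bseq 'I_N *
      ('I_m * (maxlen q).-bseq 'I_N * (maxlen q).-bseq 'I_N)) +
   ('I_C.+1 * ('I_m * C.-bseq 'I_N) * (maxlen q).-bseq 'I_N))%type.

Definition basis_word q : finType :=
  {x : 'I_m * (maxlen q).-bseq 'I_N | tdeg (x.1, x.2 : seq 'I_N) == q}.

(** The row of [inl] is [y_j w r w'] for an algebra relation [r], that of [inr] is [r w] for a
    module relation [r], both read on the words of degree [q]. The entries are sums of coordinates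
    of [p], so they make sense over every commutative ring. *)
Definition relmx_entry (R : comNzRingType) (p : relcoef -> R) q
    (r : rel_index q) (x : basis_word q) : R :=
  match r with
  | inl (t, i, (j, w, w')) => \sum_(u : C.-bseq 'I_N | wdeg d u == t)
      p (inl (t, i, u)) *+ ((j == (val x).1) && (w ++ u ++ w' == (val x).2))
  | inr (t, i, w) =>
      \sum_(u : 'I_m * C.-bseq 'I_N | tdeg (u.1, u.2 : seq 'I_N) == D0 + t%:Z)
      p (inr (t, i, u)) *+ ((u.1 == (val x).1) && (u.2 ++ w == (val x).2))
  end.

Definition relmx (R : comNzRingType) (p : relcoef -> R) q :
    'M[R]_(#|rel_index q|, #|basis_word q|) :=
  \matrix_(i, j) relmx_entry p (enum_val i) (enum_val j).

Lemma map_relmx (R S : comNzRingType) (f : {rmorphism R -> S}) p q :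
  map_mx f (relmx p q) = relmx (f \o p) q.
Proof.
apply/matrixP => i j; rewrite !mxE.
case: (enum_val i) => [[[t a] [[l w] w']]|[[t a] w]] /=; rewrite rmorph_sum;
  by apply: eq_bigr => u _; rewrite rmorphMn.
Qed.

End RelationMatrix.

Lemma linear_comb (k : fieldType) (V W : lmodType k) (I : Type) (s : seq I)
    (P : pred I) (l : I -> V -> k) (w : I -> W) :
  (forall i, linear (l i : V -> k^o)) ->
  linear (fun v => \sum_(i <- s | P i) l i v *: w i).
Proof.
move=> lin_l c u v; rewrite scaler_sumr -big_split; apply: eq_bigr => i _ /=.
by rewrite (lin_l i) scalerDl -scalerA.
Qed.

(** What the computation of graded pieces needs from the algebra; it holds for [A] and for its
    enveloping algebra, so that modules and bimodules are treated alike. The last clause uses all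
    homogeneous kernel elements of degree at most [C], not a chosen set of relations. *)
Definition presented (k : fieldType) (B : algType k) (grB : nat -> B -> Prop)
    (N : nat) (z : 'I_N -> B) (d : 'I_N -> nat) (C : nat) :=
  [/\ forall i, (0 < d i)%N,
      forall b, exists f, b = free_eval z f,
      forall i b, grB i b -> exists2 f, free_homog d i f & b = free_eval z f,
      forall s, grB (wdeg d s) (word_eval z s)
    & forall f, free_eval z f = 0 ->
        ideal_gen (fun r : free_alg k N => free_eval z r = 0 /\
          exists2 q, free_homog d q r & (q <= C)%N) f].

(** * Graded pieces of a module over a presented algebra *)

Section Core.
Variables (k : fieldType) (B : algType k) (grB : nat -> B -> Prop).
Variables (N : nat) (z : 'I_N -> B) (d : 'I_N -> nat) (C : nat).
Hypothesis presB : presented grB z d C.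
Variables (M : rmodule B) (gr : int -> M -> Prop).
Hypothesis gradedM : graded_rmodule grB gr.
Variables (m : nat) (y : 'I_m -> M) (e : 'I_m -> int) (D0 : int).
Hypothesis D0_le_e : forall j, D0 <= e j.
Hypothesis gr_y : forall j, gr (e j) (y j).
Hypothesis gen_y : forall v, rsubmod_gen (range_of y) v.
Hypothesis rel_y : forall v : free_rmod B m, free_rmod_eval y v = 0 ->
  rsubmod_gen (fun r : free_rmod B m => free_rmod_eval y r = 0 /\
    exists2 q, free_rmod_gr grB e q r & q <= D0 + C%:Z) v.

Notation F := (free_alg k N).
Notation FM := {ffun 'I_m -> F}.
Notation mon := (@mon k N).
Notation tdeg := (tdeg d e).

Definition fm_eval (P : FM) : M := \sum_j ract (y j) (free_eval z (P j)).

Definition word_val (x : 'I_m * seq 'I_N) : M := ract (y x.1) (word_eval z x.2).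

Lemma gen_deg_gt0 i : (0 < d i)%N. Proof. by case: presB. Qed.

Lemma fm_eval_linear : linear fm_eval.
Proof.
move=> c P Q; rewrite scaler_sumr -big_split; apply: eq_bigr => j _ /=.
by rewrite ffunZD free_eval_linear ract_linr.
Qed.

Lemma fm_eval_bvec j f : fm_eval (bvec j f) = ract (y j) (free_eval z f).
Proof.
rewrite /fm_eval (bigD1 j) //= ffunE eqxx big1 ?addr0 // => j' /negPf j'j.
by rewrite ffunE j'j free_eval0 (linear_fun0 (ract_linr _)).
Qed.

Lemma fm_eval_mon j s : fm_eval (bvec j (mon s)) = word_val (j, s).
Proof. by rewrite fm_eval_bvec free_eval_mon. Qed.

Lemma fm_eval_act P f : fm_eval (fm_act P f) = ract (fm_eval P) (free_eval z f).
Proof.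
have lin_r := @ract_linl _ _ M (free_eval z f).
have {1}-> : fm_act P f = fm_act (\sum_j (1 : k) *: bvec j (P j)) f.
  by congr fm_act; rewrite [LHS]bvec_sum; apply: eq_bigr => j _; rewrite scale1r.
rewrite (linear_lincomb _ _ _ _ (fm_act_linl f)).
rewrite (linear_lincomb _ _ _ _ fm_eval_linear).
have -> : fm_eval P = \sum_j (1 : k) *: fm_eval (bvec j (P j)).
  by apply: eq_bigr => j _; rewrite scale1r fm_eval_bvec.
rewrite (linear_lincomb _ _ _ _ lin_r); apply: eq_bigr => j _.
by rewrite fm_act_bvec !fm_eval_bvec free_evalM ractM.
Qed.

Definition fm_homog (q : int) (P : FM) :=
  forall j s, FMonom s \in msupp (P j) -> tdeg (j, s) = q.

Lemma fm_homog_subspace q : subspace (fm_homog q).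
Proof.
split=> [j s|c P Q hP hQ j s]; first by rewrite ffunE msupp0.
rewrite ffunZD => /(fsubsetP (msuppD_le _ _)).
rewrite in_fsetU => /orP[|]; last exact: hQ.
by move=> /(fsubsetP (msuppZ_le _ _)); apply: hP.
Qed.

Lemma fm_homog_mon j s : fm_homog (tdeg (j, s)) (bvec j (mon s)).
Proof.
move=> j' s'; rewrite ffunE; case: eqP => [->|_]; last by rewrite msupp0.
by rewrite msuppU1 in_fset1 => /eqP [->].
Qed.

Lemma fcoeff_linear (j : 'I_m) (s : seq 'I_N) :
  linear (fun P : FM => mcoeff (FMonom s) (P j) : k^o).
Proof. by move=> c P Q; rewrite ffunZD; apply: mcoeff_linear. Qed.

Lemma mcoeff_bvec (j : 'I_m) (s : seq 'I_N) (j' : 'I_m) (s' : seq 'I_N) :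
  mcoeff (FMonom s') (bvec j (mon s) j') = ((j == j') && (s == s'))%:R.
Proof.
rewrite ffunE eq_sym; case: eqP => [_|]; last by rewrite mcoeff0.
by rewrite mcoeff_mon.
Qed.

Lemma free_homogE t (f : F) : (t <= C)%N -> free_homog d t f ->
  f = \sum_(u : C.-bseq 'I_N | wdeg d u == t) mcoeff (FMonom u) f *: mon u.
Proof.
move=> tC hf.
apply: (free_alg_ind_supp (S := fun f => f = \sum_(u : C.-bseq 'I_N | wdeg d u == t)
    mcoeff (FMonom u) f *: mon u)) => [|s sf].
  apply: (linear_eq_subspace (h := id)) => //.
  by apply: linear_comb => u; apply: mcoeff_linear.
have ds : wdeg d s = t := hf _ sf.
have sC : (size s <= C)%N by apply: leq_trans (size_le_wdeg s gen_deg_gt0) _; rewrite ds.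
rewrite (bigD1 (Bseq sC)) /= ?ds // mcoeff_mon eqxx scale1r big1 ?addr0 //.
move=> u /andP[_ us]; rewrite mcoeff_mon eq_sym.
by rewrite -[_ == s]/(u == Bseq sC) (negPf us) scale0r.
Qed.

Lemma fm_homogE L q (P : FM) : (forall s j, tdeg (j, s) = q -> size s <= L)%N ->
  fm_homog q P ->
  P = \sum_(u : 'I_m * L.-bseq 'I_N | tdeg (u.1, u.2 : seq 'I_N) == q)
        mcoeff (FMonom u.2) (P u.1) *: bvec u.1 (mon u.2).
Proof.
move=> sL hP.
apply: (fm_ind_supp (S := fun P =>
    P = \sum_(u : 'I_m * L.-bseq 'I_N | tdeg (u.1, u.2 : seq 'I_N) == q)
        mcoeff (FMonom u.2) (P u.1) *: bvec u.1 (mon u.2))) => [|j s sP].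
  apply: (linear_eq_subspace (h := id)) => //.
  by apply: linear_comb => u; apply: fcoeff_linear.
have ds := hP _ _ sP; have sL' := sL _ _ ds.
rewrite (bigD1 (j, Bseq sL')) /= ?ds // mcoeff_bvec !eqxx scale1r big1 ?addr0 //.
move=> [j' u] /andP[_ us]; rewrite mcoeff_bvec /=.
case: eqP => [jj'|_]; last by rewrite scale0r.
case: eqP => [su|_]; last by rewrite scale0r.
by case/eqP: us; rewrite jj'; congr (_, _); apply: val_inj.
Qed.

Lemma size_tdeg L s j q : (q <= D0 + L%:Z)%R -> tdeg (j, s) = q -> (size s <= L)%N.
Proof.
rewrite /tdeg /= => qL dq; apply: leq_trans (size_le_wdeg s gen_deg_gt0) _.
by have := D0_le_e j; lia.
Qed.

Section Relations.
(** In each degree in range the rows of [p] are relations and span all of them; since only row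
    spaces matter, redundant rows are harmless. *)
Variable p : relcoef C N m -> k.
Hypothesis p_algebra : forall (t : 'I_C.+1) i,
  \sum_(u : C.-bseq 'I_N | wdeg d u == t) p (inl (t, i, u)) *: word_eval z u = 0.
Hypothesis p_algebra_span : forall (t : 'I_C.+1) (c : C.-bseq 'I_N -> k),
  \sum_(u : C.-bseq 'I_N | wdeg d u == t) c u *: word_eval z u = 0 ->
  exists a, forall u : C.-bseq 'I_N, wdeg d u == t -> c u = \sum_i a i * p (inl (t, i, u)).
Hypothesis p_module : forall (t : 'I_C.+1) i,
  \sum_(u : 'I_m * C.-bseq 'I_N | tdeg (u.1, u.2 : seq 'I_N) == D0 + t%:Z)
    p (inr (t, i, u)) *: word_val (u.1, u.2 : seq 'I_N) = 0.
Hypothesis p_module_span : forall (t : 'I_C.+1) (c : 'I_m * C.-bseq 'I_N -> k),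
  \sum_(u : 'I_m * C.-bseq 'I_N | tdeg (u.1, u.2 : seq 'I_N) == D0 + t%:Z)
    c u *: word_val (u.1, u.2 : seq 'I_N) = 0 ->
  exists a, forall u : 'I_m * C.-bseq 'I_N,
    tdeg (u.1, u.2 : seq 'I_N) == D0 + t%:Z ->
    c u = \sum_i a i * p (inr (t, i, u)).

Definition algebra_rel (t : 'I_C.+1) i (j : 'I_m) (w w' : seq 'I_N) : FM :=
  \sum_(u : C.-bseq 'I_N | wdeg d u == t)
    p (inl (t, i, u)) *: bvec j (mon (w ++ u ++ w')).

Definition module_rel (t : 'I_C.+1) i (w : seq 'I_N) : FM :=
  \sum_(u : 'I_m * C.-bseq 'I_N | tdeg (u.1, u.2 : seq 'I_N) == D0 + t%:Z)
    p (inr (t, i, u)) *: bvec u.1 (mon (u.2 ++ w)).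

Definition defining_rel (P : FM) :=
  (exists t i j w w', P = algebra_rel t i j w w') \/
  (exists t i w, P = module_rel t i w).

(** A linear span, to be compared with a row space; it is nevertheless a submodule, because its
    generators already include the multiples of the relations by words. *)
Definition relspan := Defs.span defining_rel.

Lemma relspan_subspace : subspace relspan.
Proof. exact: span_subspace. Qed.

Lemma relspan_rel P : defining_rel P -> relspan P.
Proof. exact: span_incl. Qed.

Lemma relspan_act P f : relspan P -> relspan (fm_act P f).
Proof.
move=> KP; apply: (free_alg_ind (S := fun f => relspan (fm_act P f))) => [|s].
  by apply: preim_subspace relspan_subspace; apply: fm_act_linr.
apply: (KP (fun P => relspan (fm_act P (mon s)))) => [|Q].
  by apply: preim_subspace relspan_subspace; apply: fm_act_linl.
move=> [[t [i [j [w [w' ->]]]]]|[t [i [w ->]]]]; apply: relspan_rel.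
  left; exists t, i, j, w, (w' ++ s).
  rewrite /algebra_rel (linear_lincomb _ _ _ _ (fm_act_linl (mon s))).
  by apply: eq_bigr => u _; rewrite fm_act_bvec -mon_cat -!catA.
right; exists t, i, (w ++ s).
rewrite /module_rel (linear_lincomb _ _ _ _ (fm_act_linl (mon s))).
by apply: eq_bigr => u _; rewrite fm_act_bvec -mon_cat -!catA.
Qed.

Lemma mul_mid_linear (w w' : seq 'I_N) : linear (fun f => mon w * f * mon w').
Proof.
move=> c f g.
apply: etrans (congr1 (fun h => h * mon w') (free_mulr_linear (mon w) c f g)) _.
exact: free_mull_linear.
Qed.

Lemma bvec_mid_linear (j : 'I_m) (w w' : seq 'I_N) :
  linear (fun f => bvec j (mon w * f * mon w')).
Proof.
move=> c f g; apply: etrans (congr1 _ (mul_mid_linear w w' c f g)) _.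
exact: bvec_linear.
Qed.

Lemma relspan_bvec (j : 'I_m) (f : F) : free_eval z f = 0 -> relspan (bvec j f).
Proof.
move=> f0; have [_ _ _ _ kerB] := presB.
(* Allowing words on both sides makes the condition stable under two-sided multiplication, as
   elimination of [ideal_gen] demands. *)
pose S f := forall w w', relspan (bvec j (mon w * f * mon w')).
suff /(_ [::] [::]) : S f by rewrite mon_nil mul1r mulr1.
apply: (kerB f f0) => [|r [r0 [t hr tC]]].
  have subS : subspace S.
    split=> [w w'|c g h Sg Sh w w'].
      rewrite mulr0 mul0r; have := relspan_subspace => -[K0 _].
      suff -> : bvec j (0 : F) = 0 by [].
      by apply/ffunP => j'; rewrite !ffunE if_same.
    rewrite (bvec_mid_linear j w w').
    by apply: (subspaceZD relspan_subspace); [apply: Sg | apply: Sh].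
  split=> [|a b Sa]; first exact: subS.
  split=> w w'.
    pose h b := bvec j (mon w * (a * b) * mon w').
    apply: (@free_alg_ind _ _ (fun b => relspan (h b)) b) => [|s].
      apply: (preim_subspace (f := h)) relspan_subspace => c u v.
      apply: etrans (congr1 (fun x => bvec j (mon w * x * mon w'))
        (free_mulr_linear a c u v)) _.
      exact: bvec_mid_linear.
    by rewrite /h mulrA -mulrA -mon_cat; apply: Sa.
  pose h b := bvec j (mon w * (b * a) * mon w').
  apply: (@free_alg_ind _ _ (fun b => relspan (h b)) b) => [|s].
    apply: (preim_subspace (f := h)) relspan_subspace => c u v.
    apply: etrans (congr1 (fun x => bvec j (mon w * x * mon w'))
      (free_mull_linear a c u v)) _.
    exact: bvec_mid_linear.
  by rewrite /h mulrA -mon_cat; apply: Sa.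
move=> w w'; pose o : 'I_C.+1 := Ordinal (tC : (t < C.+1)%N).
have [/= a aE] : exists a, forall u : C.-bseq 'I_N, wdeg d u == o ->
    mcoeff (FMonom u) r = \sum_i a i * p (inl (o, i, u)).
  apply: p_algebra_span => /=; rewrite -[RHS]r0 {2}(free_homogE tC hr).
  rewrite (linear_lincomb _ _ _ _ (free_eval_linear z)).
  by apply: eq_bigr => u _; rewrite free_eval_mon.
rewrite (free_homogE tC hr).
rewrite (linear_lincomb _ _ _ _ (bvec_mid_linear j w w')).
under eq_bigr => u du do rewrite aE // scaler_suml.
rewrite exchange_big /=; apply: (subspace_sum relspan_subspace) => i _.
suff -> : \sum_(u : C.-bseq 'I_N | wdeg d u == t)
    (a i * p (inl (o, i, u))) *: bvec j (mon w * mon u * mon w') =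
    a i *: algebra_rel o i j w w'.
  apply: (subspaceZ relspan_subspace).
  by apply: relspan_rel; left; do 5!eexists.
rewrite scaler_sumr; apply: eq_bigr => u _.
by rewrite scalerA !mon_cat mulrA.
Qed.

Lemma relspan_homog q P : q <= D0 + C%:Z -> fm_homog q P -> fm_eval P = 0 ->
  relspan P.
Proof.
move=> qC hP P0; have [q0|q0] := ltP q D0.
  (* Below [D0] there are no words at all, so any length bound holds vacuously and the sum is
     empty. *)
  rewrite [P](fm_homogE (L := 0) _ hP) => [|s j dq]; last first.
    by have := D0_le_e j; move: dq; rewrite /tdeg /=; lia.
  rewrite big1 => [|u /eqP dq]; first by case: relspan_subspace.
  by have := D0_le_e u.1; move: dq; rewrite /tdeg /=; lia.
have [t [tq tC]] : exists t, q = D0 + t%:Z /\ (t < C.+1)%N.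
  by exists `|q - D0|%N; lia.
have sL s j : tdeg (j, s) = q -> (size s <= C)%N by apply: size_tdeg.
have [a aE] : exists a, forall u : 'I_m * C.-bseq 'I_N,
    tdeg (u.1, u.2 : seq 'I_N) == D0 + (Ordinal tC)%:Z ->
    mcoeff (FMonom u.2) (P u.1) = \sum_i a i * p (inr (Ordinal tC, i, u)).
  apply: p_module_span => /=; rewrite -[RHS]P0 {2}(fm_homogE sL hP) -tq.
  rewrite (linear_lincomb _ _ _ _ fm_eval_linear).
  by apply: eq_bigr => u _; rewrite fm_eval_mon.
rewrite (fm_homogE sL hP) tq.
under eq_bigr => u du do rewrite aE // scaler_suml.
rewrite exchange_big /=; apply: (subspace_sum relspan_subspace) => i _.
suff -> : \sum_(u : 'I_m * C.-bseq 'I_N | tdeg (u.1, u.2 : seq 'I_N) == D0 + t)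
    (a i * p (inr (Ordinal tC, i, u))) *: bvec u.1 (mon u.2)
    = a i *: module_rel (Ordinal tC) i [::].
  apply: (subspaceZ relspan_subspace).
  by apply: relspan_rel; right; do 3!eexists.
rewrite scaler_sumr; apply: eq_bigr => u _.
by rewrite scalerA cats0.
Qed.

(** The kernel is reached in two stages. The image of [P] in the free [B]-module is a combination of
    module relations, which lifts to some [Q] in [relspan]; then the components of [P - Q] vanish in
    [B] and are handled by the algebra relations. *)
Lemma relspan_ker P : fm_eval P = 0 -> relspan P.
Proof.
move=> P0; pose v : free_rmod B m := [ffun j => free_eval z (P j)].
have v0 : free_rmod_eval y v = 0.
  by rewrite -[RHS]P0; apply: eq_bigr => j _; rewrite ffunE.
pose S (u : free_rmod B m) := exists2 Q, relspan Q & forall j, u j = free_eval z (Q j).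
have [Q KQ vQ] : S v.
  apply: (rel_y v0) => [|r [r0 [q hr qC]]].
    split=> [|u b [Q KQ uQ]].
      split=> [|c u u' [Q KQ uQ] [Q' KQ' uQ']].
        exists 0 => [|j]; first exact: (subspace0 relspan_subspace).
        by rewrite !ffunE free_eval0.
      exists (c *: Q + Q') => [|j]; first exact: (subspaceZD relspan_subspace).
      by rewrite !ffunZD uQ uQ' free_eval_linear.
    have [_ surj _ _ _] := presB; have [f ->] := surj b.
    exists (fm_act Q f) => [|j]; first exact: relspan_act.
    by rewrite fm_actE free_evalM -uQ ffunE.
  have [_ _ lift _ _] := presB.
  have [f fP] : exists f : 'I_m -> F, forall j, r j = free_eval z (f j) /\
      forall s, FMonom s \in msupp (f j) -> tdeg (j, s) = q.
    apply: (choice (fun j f => r j = free_eval z f /\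
      forall s, FMonom s \in msupp f -> tdeg (j, s) = q)) => j.
    (* A component of nonnegative degree lifts to a homogeneous element; one of negative degree is
       zero and is lifted by zero. *)
    have := hr j; case Dq: (q - e j) => [i|i].
      move=> /lift[f hf rf]; exists f; split=> // s /hf; rewrite /tdeg /= => ds.
      by rewrite -[wdeg d s]/(word_deg d (FMonom s)) ds -Dq addrC subrK.
    by exists 0; rewrite free_eval0; split=> // s; rewrite msupp0.
  exists [ffun j => f j] => [|j]; last by rewrite ffunE; case: (fP j).
  apply: (relspan_homog qC) => [j s|]; first by rewrite ffunE; case: (fP j) => _; apply.
  by rewrite -[RHS]r0; apply: eq_bigr => j _; rewrite ffunE; case: (fP j) => ->.
rewrite -[P](subrK Q); apply: (subspaceD relspan_subspace) => //.
rewrite [P - Q]bvec_sum; apply: (subspace_sum relspan_subspace) => j _.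
apply: relspan_bvec; have := vQ j; rewrite ffunE => PQ.
have -> : (P - Q) j = (-1 : k) *: Q j + P j by rewrite !ffunE scaleN1r addrC.
by rewrite free_eval_linear PQ scaleN1r addNr.
Qed.

Lemma word_val_cat j s w : word_val (j, s ++ w) = ract (word_val (j, s)) (word_eval z w).
Proof. by rewrite /word_val /= word_eval_cat ractM. Qed.

Lemma fm_eval_algebra_rel t i j w w' : fm_eval (algebra_rel t i j w w') = 0.
Proof.
rewrite (linear_lincomb _ _ _ _ fm_eval_linear).
pose h b := ract (y j) (word_eval z w * b * word_eval z w').
have lin_h : linear h.
  by move=> c a b; rewrite /h mulrDr mulrDl -scalerAr -scalerAl ract_linr.
transitivity (h 0); last first.
  exact: linear_fun0.
rewrite -(p_algebra t i) (linear_lincomb _ _ _ _ lin_h).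
apply: eq_bigr => u _; rewrite fm_eval_mon /word_val /=.
by rewrite /h !word_eval_cat mulrA.
Qed.

Lemma fm_eval_module_rel t i w : fm_eval (module_rel t i w) = 0.
Proof.
rewrite (linear_lincomb _ _ _ _ fm_eval_linear).
have lin_r := @ract_linl _ _ M (word_eval z w).
transitivity (ract (0 : M) (word_eval z w)); last exact: (linear_fun0 lin_r).
rewrite -[X in ract X _](p_module t i) (linear_lincomb _ _ _ _ lin_r).
by apply: eq_bigr => u _; rewrite fm_eval_mon -word_val_cat.
Qed.

Lemma fm_homog_algebra_rel (t : 'I_C.+1) i j w w' :
  fm_homog (e j + (wdeg d w + (t + wdeg d w'))%N%:Z) (algebra_rel t i j w w').
Proof.
apply: (subspace_sum (fm_homog_subspace _)) => u /eqP <-.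
apply: (subspaceZ (fm_homog_subspace _)); rewrite -!wdeg_cat.
exact: fm_homog_mon.
Qed.

Lemma fm_homog_module_rel (t : 'I_C.+1) i w :
  fm_homog (D0 + t%:Z + (wdeg d w)%:Z) (module_rel t i w).
Proof.
apply: (subspace_sum (fm_homog_subspace _)) => u /eqP <-.
apply: (subspaceZ (fm_homog_subspace _)).
rewrite /tdeg /= -addrA -PoszD -wdeg_cat; exact: fm_homog_mon.
Qed.

Section Degree.
Variable q : int.
Notation L := (maxlen D0 q).
Notation basis_word := (basis_word D0 d e q).
Notation relmx := (relmx D0 d e p q).

Definition bword (x : basis_word) : 'I_m * seq 'I_N := ((val x).1, (val x).2 : seq _).

Definition fm_row (P : FM) : 'rV[k]_#|basis_word| :=
  \row_i mcoeff (FMonom (bword (enum_val i)).2) (P (bword (enum_val i)).1).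

Lemma fm_row_linear : linear fm_row.
Proof.
move=> c P Q; apply/rowP => i; rewrite !mxE.
exact: (fcoeff_linear (bword (enum_val i)).1 (bword (enum_val i)).2 c P Q).
Qed.

Definition row_val (u : 'rV[k]_#|basis_word|) : M :=
  \sum_i u 0 i *: word_val (bword (enum_val i)).

Lemma row_val_linear : linear row_val.
Proof. by apply: linear_comb => i c u v; rewrite !mxE. Qed.

Lemma size_maxlen s j : tdeg (j, s) = q -> (size s <= L)%N.
Proof.
move=> dq; apply: size_tdeg dq; rewrite /maxlen.
by have := ler_norm (q - D0); lia.
Qed.

Lemma row_val_homog q' P : fm_homog q' P ->
  row_val (fm_row P) = if q' == q then fm_eval P else 0.
Proof.
move=> hP; have lin_rv : linear (row_val \o fm_row).
  by move=> c u v; rewrite /= fm_row_linear row_val_linear.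
apply: (fm_ind_supp (S := fun P => row_val (fm_row P) =
    if q' == q then fm_eval P else 0)) => [|j s sP].
  apply: (linear_eq_subspace lin_rv).
  case: (q' == q) => c u v; first exact: fm_eval_linear.
  by rewrite scaler0 addr0.
rewrite /row_val; have := hP _ _ sP; case: eqP => [-> ds|q'q ds].
  have sL := size_maxlen ds.
  have xq : tdeg ((j, Bseq sL).1, (j, Bseq sL).2 : seq 'I_N) == q by apply/eqP.
  pose x : basis_word := Sub (j, Bseq sL) xq.
  rewrite (bigD1 (enum_rank x)) //= big1 => [|i ix].
    by rewrite mxE enum_rankK mcoeff_bvec /= !eqxx scale1r addr0 fm_eval_mon.
  rewrite mxE mcoeff_bvec /bword /=.
  case: eqP => [j1|_]; last by rewrite scale0r.
  case: eqP => [s1|_]; last by rewrite scale0r.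
  case/eqP: ix; rewrite -[i]enum_valK; congr enum_rank; apply: val_inj.
  by rewrite /= [LHS]surjective_pairing; congr (_, _) => //; apply: val_inj.
rewrite big1 // => i _; rewrite mxE mcoeff_bvec /bword /=.
case: eqP => [j1|_]; last by rewrite scale0r.
case: eqP => [s1|_]; last by rewrite scale0r.
have /eqP := valP (enum_val i); rewrite -s1 -j1 ds => qq.
by case: q'q.
Qed.

(** If [w] or [w'] is longer than [L], no basis word contains it and the vector is zero; otherwise
    it is literally a row of [relmx]. *)
Lemma fm_row_algebra_rel t i j (w w' : seq 'I_N) :
  (fm_row (algebra_rel t i j w w') <= relmx)%MS.
Proof.
have coefE x : fm_row (algebra_rel t i j w w') 0 x =
    \sum_(u : C.-bseq 'I_N | wdeg d u == t) p (inl (t, i, u)) *+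
     ((j == (bword (enum_val x)).1) && (w ++ u ++ w' == (bword (enum_val x)).2)).
  rewrite mxE (linear_lincomb _ _ _ _ (fcoeff_linear _ _)).
  by apply: eq_bigr => u _; rewrite mcoeff_bvec [LHS]mulr_natr.
have [wL|wL] := leqP (size w) L; last first.
  suff -> : fm_row (algebra_rel t i j w w') = 0 by apply: sub0mx.
  apply/rowP => x; rewrite coefE mxE big1 // => u _.
  case: eqP => // _; case: eqP => // /(congr1 size); rewrite size_cat /= => sz.
  by have := size_bseq (val (enum_val x)).2; rewrite -sz; lia.
have [wL'|wL'] := leqP (size w') L; last first.
  suff -> : fm_row (algebra_rel t i j w w') = 0 by apply: sub0mx.
  apply/rowP => x; rewrite coefE mxE big1 // => u _.
  case: eqP => // _; case: eqP => // /(congr1 size); rewrite !size_cat /= => sz.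
  by have := size_bseq (val (enum_val x)).2; rewrite -sz; lia.
pose r : rel_index D0 C N m q := inl (t, i, (j, Bseq wL, Bseq wL')).
suff -> : fm_row (algebra_rel t i j w w') = row (enum_rank r) relmx by apply: row_sub.
by apply/rowP => x; rewrite coefE mxE mxE enum_rankK.
Qed.

Lemma fm_row_module_rel t i (w : seq 'I_N) :
  (fm_row (module_rel t i w) <= relmx)%MS.
Proof.
have coefE x : fm_row (module_rel t i w) 0 x =
    \sum_(u : 'I_m * C.-bseq 'I_N | tdeg (u.1, u.2 : seq 'I_N) == D0 + t%:Z)
      p (inr (t, i, u)) *+
      ((u.1 == (bword (enum_val x)).1) && (u.2 ++ w == (bword (enum_val x)).2)).
  rewrite mxE (linear_lincomb _ _ _ _ (fcoeff_linear _ _)).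
  by apply: eq_bigr => u _; rewrite mcoeff_bvec [LHS]mulr_natr.
have [wL|wL] := leqP (size w) L; last first.
  suff -> : fm_row (module_rel t i w) = 0 by apply: sub0mx.
  apply/rowP => x; rewrite coefE mxE big1 // => u _.
  case: eqP => // _; case: eqP => // /(congr1 size); rewrite !size_cat /= => sz.
  by have := size_bseq (val (enum_val x)).2; rewrite -sz; lia.
pose r : rel_index D0 C N m q := inr (t, i, Bseq wL).
suff -> : fm_row (module_rel t i w) = row (enum_rank r) relmx by apply: row_sub.
by apply/rowP => x; rewrite coefE mxE mxE enum_rankK.
Qed.

Lemma fm_row_relspan P : relspan P -> (fm_row P <= relmx)%MS.
Proof.
move=> KP; apply: (KP (fun P => (fm_row P <= relmx)%MS)) => [|Q]; last first.
  move=> [[t [i [j [w [w' ->]]]]]|[t [i [w ->]]]];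
    [exact: fm_row_algebra_rel | exact: fm_row_module_rel].
apply: (preim_subspace fm_row_linear (S := fun u => (u <= relmx)%MS)).
split=> [|c u v hu hv]; first exact: sub0mx.
by rewrite addmx_sub // scalemx_sub.
Qed.

Lemma row_val_row_relmx r : row_val (row r relmx) = 0.
Proof.
have rel_eq0 q' P : fm_homog q' P -> fm_eval P = 0 -> row_val (fm_row P) = 0.
  by move=> /row_val_homog -> ->; rewrite if_same.
rewrite -[r]enum_valK; case: (enum_val r) => [[[t i] [[j w] w']]|[[t i] w]].
  rewrite -[RHS](rel_eq0 _ _ (@fm_homog_algebra_rel t i j w w')); last first.
    exact: fm_eval_algebra_rel.
  congr row_val; apply/rowP => x; rewrite !mxE enum_rankK.
  rewrite (linear_lincomb _ _ _ _ (fcoeff_linear _ _)).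
  by apply: eq_bigr => u _; rewrite mcoeff_bvec [RHS]mulr_natr.
rewrite -[RHS](rel_eq0 _ _ (@fm_homog_module_rel t i w)); last first.
  exact: fm_eval_module_rel.
congr row_val; apply/rowP => x; rewrite !mxE enum_rankK.
rewrite (linear_lincomb _ _ _ _ (fcoeff_linear _ _)).
by apply: eq_bigr => u _; rewrite mcoeff_bvec [RHS]mulr_natr.
Qed.

(** A relation in degree [q] lies in [relspan], but perhaps through relations of other degrees; the
    linear map [fm_row] discards those and leaves a combination of rows. Conversely, every row comes
    from a homogeneous element of the kernel. *)
Lemma row_val_relmx (u : 'rV_#|basis_word|) : row_val u = 0 <-> (u <= relmx)%MS.
Proof.
split=> [u0|/submxP[a ->]]; last first.
  rewrite mulmx_sum_row (linear_lincomb _ _ _ _ row_val_linear) big1 // => r _.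
  by rewrite row_val_row_relmx scaler0.
pose P : FM := \sum_i u 0 i *: bvec (bword (enum_val i)).1 (mon (bword (enum_val i)).2).
have uE : fm_row P = u.
  apply/rowP => x; rewrite mxE (linear_lincomb _ _ _ _ (fcoeff_linear _ _)).
  rewrite (bigD1 x) //= mcoeff_bvec !eqxx [_ *: _]mulr1 big1 ?addr0 // => i ix.
  rewrite mcoeff_bvec; case: eqP => [j1|_]; last by rewrite scaler0.
  case: eqP => [s1|_]; last by rewrite scaler0.
  case/eqP: ix; apply: enum_val_inj; apply: val_inj.
  rewrite [LHS]surjective_pairing [RHS]surjective_pairing.
  by congr (_, _) => //; apply: val_inj.
have hP : fm_homog q P.
  apply: (subspace_sum (fm_homog_subspace _)) => i _.
  apply: (subspaceZ (fm_homog_subspace _)).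
  rewrite -[X in fm_homog X](eqP (valP (enum_val i))); exact: fm_homog_mon.
rewrite -uE; apply: fm_row_relspan; apply: relspan_ker.
by have := row_val_homog hP; rewrite eqxx uE u0 => <-.
Qed.

End Degree.
End Relations.

Lemma fm_eval_surj v : exists P, v = fm_eval P.
Proof.
apply: (gen_y v (S := fun v => exists P, v = fm_eval P)) => [|_ [j ->]].
  split=> [|u b [P ->]].
    split=> [|c u v' [P ->] [Q ->]]; first by exists 0; rewrite (linear_fun0 fm_eval_linear).
    by exists (c *: P + Q); rewrite fm_eval_linear.
  have [_ surj _ _ _] := presB; have [f ->] := surj b.
  by exists (fm_act P f); rewrite fm_eval_act.
exists (bvec j (mon [::])).
by rewrite fm_eval_mon /word_val /= /word_eval big_nil ract1.
Qed.

Lemma gr_word_val x : gr (tdeg x) (word_val x).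
Proof.
have [_ gr_act] := gradedM; have [_ _ _ gr_word _] := presB.
by apply: gr_act; [apply: gr_y | apply: gr_word].
Qed.

Lemma gr_row_val q v :
  gr q v <-> exists u : 'rV_#|basis_word D0 d e q|, v = row_val u.
Proof.
have [grM _] := gradedM; have [gr_sub _ _] := grM; split=> [|[u ->]]; last first.
  apply: (subspace_sum (gr_sub q)) => i _; apply: (subspaceZ (gr_sub q)).
  rewrite -[X in gr X](eqP (valP (enum_val i))); exact: gr_word_val.
pose S v := exists u : 'rV_#|basis_word D0 d e q|, v = row_val u.
have subS : subspace S.
  split=> [|c _ _ [u ->] [u' ->]]; last by exists (c *: u + u'); rewrite row_val_linear.
  by exists 0; rewrite (linear_fun0 (@row_val_linear q)).
have [P ->] := fm_eval_surj v; have [l [c [-> _]]] := fm_decomp P.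
rewrite (linear_lincomb _ _ _ _ fm_eval_linear) => grP.
pose deg (x : 'I_m * {fmonom 'I_N}) := tdeg (x.1, x.2 : seq _).
rewrite (grading_sum_homog (dF := deg) grM _ grP) => [|x].
  apply: (subspace_sum subS) => x /eqP; rewrite /deg => dx.
  apply: (subspaceZ subS).
  exists (fm_row q (bvec x.1 (mon x.2))).
  by rewrite (row_val_homog q (@fm_homog_mon x.1 x.2)) dx eqxx.
apply: (subspaceZ (gr_sub _)); rewrite fm_eval_mon; exact: gr_word_val.
Qed.

(** The order of quantifiers is essential: one point [p] of a finite-dimensional space serves all
    degrees [q]. *)
Lemma graded_piece_dim : exists p : relcoef C N m -> k,
  forall q n, has_dim (gr q) n ->
  n = (#|basis_word D0 d e q| - \rank (relmx D0 d e p q))%N.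
Proof.
have [A AP] := choice _ (fun t : 'I_C.+1 => relation_matrix
  (fun u : C.-bseq 'I_N => wdeg d u == t) (fun u : C.-bseq 'I_N => word_eval z u)).
have [A' AP'] := choice _ (fun t : 'I_C.+1 => relation_matrix
  (fun u : 'I_m * C.-bseq 'I_N => tdeg (u.1, u.2 : seq 'I_N) == D0 + t%:Z)
  (fun u : 'I_m * C.-bseq 'I_N => word_val (u.1, u.2 : seq 'I_N))).
exists (fun r => match r with inl (t, i, u) => A t i u | inr (t, i, u) => A' t i u end).
move=> q n dim_n; apply: (has_dim_corank dim_n (gr_row_val q)) => u.
apply: row_val_relmx => t;
  [by case: (AP t) | by case: (AP t) | by case: (AP' t) | by case: (AP' t)].
Qed.

End Core.

(** * Presentation of a connected graded algebra *)

Section AlgebraPresentation.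
Variables (k : fieldType) (A : algType k) (gr : nat -> A -> Prop).

Lemma ideal_gen_mono (B : lalgType k) (X Y : B -> Prop) :
  subpredp X Y -> subpredp (ideal_gen X) (ideal_gen Y).
Proof. by move=> XY b Xb S idS YS; apply: Xb => // t /XY /YS. Qed.

(* A generator of degree 0 is a scalar, so it would be redundant. *)
Lemma minimal_generator_deg_gt0 (n : nat) (x : 'I_n -> A) (d : 'I_n -> nat) :
  connected_graded gr ->
  minimal_generating (@subalg_gen k A) (fun _ => True) (range_of x) ->
  (forall i, gr (d i) (x i)) -> forall i, (0 < d i)%N.
Proof.
move=> [_ _ gr0] [gen_x min_x] gr_x i; rewrite lt0n; apply/eqP => di0.
have [c xc] : exists c : k, x i = c%:A by apply/gr0; rewrite -di0.
pose Y t := range_of x t /\ t <> x i.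
have [||_] := min_x Y _ _ (x i) (ex_intro _ i erefl); last exact.
  by move=> t [].
move=> t _ S subS YS; have /(_ I)/(_ S) := proj1 (gen_x t); apply=> // _ [j ->].
have [-> | xji] := classic (x j = x i); last by apply: YS; split=> //; exists j.
by have [sS S1 _] := subS; rewrite xc; apply: subspaceZ.
Qed.

Lemma alg_bounded_presented (D : int) :
  connected_graded gr -> alg_bounded gr D ->
  exists (n : nat) (x : 'I_n -> A) (d : 'I_n -> nat),
    [/\ n%:Z <= D, forall i, (d i)%:Z <= D & presented gr x d `|D|%N].
Proof.
move=> cgA [n [x [d [R [nD [_ min_x] x_d [gen_R _] hR]]]]].
have [grA grM gr0] := cgA; have gr_x i : gr (d i) (x i) by case: (x_d i).
have gr_word s : gr (wdeg d s) (word_eval x s).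
  elim: s => [|i s IHs]; rewrite /wdeg /word_eval ?big_nil ?big_cons.
    by apply/gr0; exists 1; rewrite scale1r.
  exact: grM.
have surj a : exists f, a = free_eval x f.
  apply: (proj1 (proj1 min_x a) I (fun a => exists f, a = free_eval x f)) => [|_ [i ->]].
    split=> [||_ _ [f ->] [g ->]].
    - split=> [|c _ _ [f ->] [g ->]]; first by exists 0; rewrite free_eval0.
      by exists (c *: f + g); rewrite free_eval_linear.
    - by exists 1; rewrite free_eval1.
    - by exists (f * g); rewrite free_evalM.
  by exists (mon k [:: i]); rewrite free_eval_mon /word_eval big_seq1.
exists n, x, d; split=> // [i|]; first by case: (x_d i).
split=> // [|i b grb|f f0].
- exact: minimal_generator_deg_gt0 cgA min_x gr_x.
- have [f bE] := surj b; pose c w := mcoeff w f.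
  have fE : free_eval x f = \sum_(w <- msupp f) c w *: word_eval x w by [].
  rewrite bE fE in grb *.
  (* An arbitrary lift is truncated to its words of degree [i]; by the grading the remaining terms
     evaluate to zero in total. *)
  exists (\sum_(w <- msupp f | wdeg d w == i) c w *: mon k w).
    apply: (subspace_sum (@free_homog_subspace k n d i)) => w /eqP <-.
    by apply: (subspaceZ (@free_homog_subspace k n d _)); apply: free_homog_mon.
  rewrite (linear_lincomb _ _ _ _ (free_eval_linear x)).
  rewrite (grading_sum_homog (dF := fun w : {fmonom 'I_n} => wdeg d w) grA _ grb).
    by apply: eq_bigr => w _; rewrite free_eval_mon.
  by move=> w; have [gr_sub _ _] := grA; apply: (subspaceZ (gr_sub _)).
(* The chosen relations are enlarged to all homogeneous kernel elements of degree at most [|D|],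
   which generate the same kernel. *)
have /proj1 := gen_R f; move=> /(_ f0); apply: ideal_gen_mono => r Rr.
split; first by apply/gen_R => S _; apply.
by have [q hq qD] := hR r Rr; exists q => //; lia.
Qed.

End AlgebraPresentation.

(** * Normal words and linear sections *)

Section LinearSection.
Variables (k : fieldType) (N : nat) (V : lmodType k).
Notation F := (free_alg k N).
Variable ev : F -> V.
Hypothesis lin_ev : linear ev.
Hypothesis ev_surj : forall v, exists f, v = ev f.

Let b (s : seq 'I_N) := ev (mon k s).

(** Words are ordered by their [pickle] codes. Any enumeration works, since the normal forms need
    only be linear, not compatible with products. *)
Let standard (s : seq 'I_N) :=
  ~ Defs.span (fun v => exists2 t : seq 'I_N,
      (choice.pickle t < choice.pickle s)%N & v = b t) (b s).

Let normal (f : F) := forall w, w \in msupp f -> standard w.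

Lemma normal_subspace : subspace normal.
Proof.
split=> [w|c f g hf hg w]; first by rewrite msupp0.
move=> /(fsubsetP (msuppD_le _ _)); rewrite in_fsetU => /orP[|]; last exact: hg.
by move=> /(fsubsetP (msuppZ_le _ _)); apply: hf.
Qed.

Lemma normal_form v : exists2 f, normal f & v = ev f.
Proof.
pose S v := exists2 f, normal f & v = ev f.
have subS : subspace S.
  split=> [|c _ _ [f nf ->] [g ng ->]].
    by exists 0; [apply: (subspace0 normal_subspace) | rewrite (linear_fun0 lin_ev)].
  exists (c *: f + g); first exact: (subspaceZD normal_subspace).
  by rewrite lin_ev.
have Sb s : S (b s).
  have [n] := ubnP (choice.pickle s); elim: n s => // n IHn s sn.
  have [std_s|/NNPP] := classic (standard s).
    by exists (mon k s) => // w; rewrite msuppU1 in_fset1 => /eqP ->.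
  by apply=> // v' [t ts ->]; apply: IHn; apply: leq_trans ts _.
have [f ->] := ev_surj v; apply: (free_alg_ind (S := fun f => S (ev f))) => [|s].
  exact: preim_subspace.
exact: Sb.
Qed.

(* The word of largest code in the support of a normal element of the kernel
   would be a combination of words of smaller codes. *)
Lemma normal_ker f : normal f -> ev f = 0 -> f = 0.
Proof.
move=> nf f0; apply: NNPP => fn0.
have {fn0} [w wf] : exists w, w \in msupp f.
  apply: NNPP => nw; apply: fn0; rewrite [f]free_algE big_seq big1 // => w wf.
  by case: nw; exists w.
have [n sn] : exists n, forall w, w \in msupp f -> (choice.pickle (w : seq 'I_N) < n)%N.
  exists (\max_(w <- msupp f) choice.pickle (w : seq 'I_N)).+1 => w' w'f; rewrite ltnS.
  exact: leq_bigmax_seq.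
elim: n sn => [|n IHn] sn; first by have := sn w wf.
have [[v [vf vn]]|nov] :=
  classic (exists v, v \in msupp f /\ choice.pickle (v : seq 'I_N) = n); last first.
  apply: IHn => v vf; have := sn v vf; rewrite ltnS leq_eqVlt => /predU1P[vn|//].
  by case: nov; exists v.
apply: (nf v vf) => S subS Sb.
have c0 : mcoeff v f != 0 by rewrite mcoeff_neq0.
have := f0; rewrite {1}[f]free_algE (linear_lincomb _ _ _ _ lin_ev).
rewrite (big_fsetD1 v) //= => /eqP; rewrite addr_eq0 => /eqP bv.
have -> : b v = (mcoeff v f)^-1 *: (mcoeff v f *: ev (mon k v)).
  by rewrite scalerA mulVf ?scale1r.
rewrite bv; apply: (subspaceZ subS); rewrite -scaleN1r; apply: (subspaceZ subS).
rewrite big_seq; apply: (subspace_sum subS) => w' ; rewrite in_fsetD1 => /andP[w'v w'f].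
apply: (subspaceZ subS); apply: Sb; exists (w' : seq 'I_N) => //.
have := sn _ w'f; rewrite vn ltnS leq_eqVlt => /predU1P[w'n|//].
case/eqP: w'v; apply/eqP; rewrite fmP; apply/eqP.
by apply: (pcan_inj choice.pickleK); rewrite w'n vn.
Qed.

(** By [normal_ker] a normal preimage is unique, so a choice of normal preimages is automatically
    linear. *)
Lemma linear_section : exists sigma : V -> F, linear sigma /\ forall v, ev (sigma v) = v.
Proof.
have [sigma sP] : exists sigma : V -> F, forall v, normal (sigma v) /\ v = ev (sigma v).
  apply: (choice (fun v f => normal f /\ v = ev f)) => v.
  by case: (normal_form v) => f; exists f.
exists sigma; split=> [c u v|v]; last by case: (sP v).
have [[nu evu] [nv evv]] := (sP u, sP v); have [nuv evuv] := sP (c *: u + v).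
have n1 : normal (c *: sigma u + sigma v) := subspaceZD normal_subspace c nu nv.
have n2 := subspaceZD normal_subspace (-1) n1 nuv.
have := normal_ker n2; rewrite !lin_ev -evu -evv -evuv scaleN1r addNr.
by move=> /(_ erefl)/eqP; rewrite scaleN1r addr_eq0 eqr_opp eq_sym => /eqP.
Qed.

End LinearSection.

Section IdealCongruence.
Variables (k : fieldType) (B : lalgType k) (X : B -> Prop).

Lemma ideal_gen_ideal : ideal (ideal_gen X).
Proof.
split=> [|a b Xa].
  split=> [S [subS _] _|c u v Xu Xv S idS XS]; first exact: subspace0.
  by have [subS _] := idS; apply: subspaceZD => //; [apply: Xu | apply: Xv].
by split=> S idS XS; have [_ /(_ a b (Xa S idS XS))[]] := idS.
Qed.

Definition icong (u v : B) := ideal_gen X (u - v).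

Lemma icong_refl u : icong u u.
Proof. by rewrite /icong subrr; have [[]] := ideal_gen_ideal. Qed.

Lemma icong_trans v u w : icong u v -> icong v w -> icong u w.
Proof.
rewrite /icong => Juv Jvw; have -> : u - w = (u - v) + (v - w) by rewrite addrA subrK.
by have [subJ _] := ideal_gen_ideal; apply: (subspaceD subJ).
Qed.

Lemma icong_mull a u v : icong u v -> icong (a * u) (a * v).
Proof. by rewrite /icong -mulrBr; have [_ idJ] := ideal_gen_ideal => /(idJ _ a)[]. Qed.

Lemma icong_mulr a u v : icong u v -> icong (u * a) (v * a).
Proof. by rewrite /icong -mulrBl; have [_ idJ] := ideal_gen_ideal => /(idJ _ a)[]. Qed.

End IdealCongruence.

(** * Presentation of the enveloping algebra *)

Section Enveloping.
Variables (k : fieldType) (A : algType k) (T : enveloping A).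

Lemma tens_linl b : linear ((@tens k A T)^~ b). Proof. by case: T. Qed.
Lemma tens_linr a : linear (@tens k A T a). Proof. by case: T a. Qed.
Lemma tens11 : tens T 1 1 = 1. Proof. by case: T. Qed.
Lemma tensM a b a' b' : tens T a b * tens T a' b' = tens T (a * a') (b' * b).
Proof. by case: T a b a' b'. Qed.
Lemma tens_universal (V : lmodType k) (f : A -> A -> V) :
  (forall b, linear (f^~ b)) -> (forall a, linear (f a)) ->
  exists h : T -> V, [/\ linear h, forall a b, h (tens T a b) = f a b
    & forall h' : T -> V, linear h' ->
        (forall a b, h' (tens T a b) = f a b) -> h' =1 h].
Proof. by case: T f => B t h1 h2 univ h3 h4 f; apply: univ. Qed.

Variables (grA : nat -> A -> Prop) (N : nat) (x : 'I_N -> A) (d : 'I_N -> nat).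
Variables (C : nat).
Hypothesis presA : presented grA x d C.
Hypothesis d_le_C : forall i, (d i <= C)%N.

Notation F := (free_alg k N).
Notation F2 := (free_alg k (N + N)).

Definition env_gens (i : 'I_(N + N)) : T :=
  match split i with inl a => tens T (x a) 1 | inr a => tens T 1 (x a) end.

Definition env_degs (i : 'I_(N + N)) : nat :=
  match split i with inl a => d a | inr a => d a end.

Definition lword (s : seq 'I_N) := map (lshift N) s.
(** Reversed because the second tensor factor multiplies in the opposite order: the product of the
    letters [1 (x) x_i] along [rword s] is [1 (x)] the value of [s]. *)
Definition rword (s : seq 'I_N) := rev (map (@rshift N N) s).

Definition linj : F -> F2 := mon_ext (fun s => mon k (lword s)).
Definition rinj : F -> F2 := mon_ext (fun s => mon k (rword s)).

Notation ev := (free_eval x).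
Notation ev2 := (free_eval env_gens).

Lemma linj_linear : linear linj. Proof. exact: mon_ext_linear. Qed.
Lemma rinj_linear : linear rinj. Proof. exact: mon_ext_linear. Qed.

Lemma linj_mon s : linj (mon k s) = mon k (lword s).
Proof. exact: (mon_ext_mon (fun s => mon k (lword s))). Qed.

Lemma rinj_mon s : rinj (mon k s) = mon k (rword s).
Proof. exact: (mon_ext_mon (fun s => mon k (rword s))). Qed.

Lemma split_lshift a : split (lshift N a : 'I_(N + N)) = inl a.
Proof. exact: (unsplitK (inl a)). Qed.

Lemma split_rshift a : split (rshift N a : 'I_(N + N)) = inr a.
Proof. exact: (unsplitK (inr a)). Qed.

Lemma word_eval_lword s : word_eval env_gens (lword s) = tens T (word_eval x s) 1.
Proof.
elim: s => [|a s IHs]; rewrite /word_eval ?big_nil ?tens11 //= !big_cons.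
by rewrite -![\prod_(_ <- _) _]/(word_eval _ _) IHs /env_gens split_lshift tensM mulr1.
Qed.

Lemma word_eval_rword s : word_eval env_gens (rword s) = tens T 1 (word_eval x s).
Proof.
elim: s => [|a s IHs]; first by rewrite /rword /word_eval !big_nil tens11.
rewrite /rword /= rev_cons -cats1 word_eval_cat IHs.
rewrite /word_eval big_seq1 big_cons /env_gens split_rshift.
by rewrite tensM mulr1.
Qed.

Lemma free_eval_linj f : ev2 (linj f) = tens T (ev f) 1.
Proof.
apply: (linear_ext_mon (h := fun f => ev2 (linj f)) (h' := fun f => tens T (ev f) 1)).
- by move=> c u v; rewrite linj_linear free_eval_linear.
- by move=> c u v; rewrite free_eval_linear tens_linl.
by move=> s; rewrite linj_mon !free_eval_mon word_eval_lword.
Qed.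

Lemma free_eval_rinj f : ev2 (rinj f) = tens T 1 (ev f).
Proof.
apply: (linear_ext_mon (h := fun f => ev2 (rinj f)) (h' := fun f => tens T 1 (ev f))).
- by move=> c u v; rewrite rinj_linear free_eval_linear.
- by move=> c u v; rewrite free_eval_linear tens_linr.
by move=> s; rewrite rinj_mon !free_eval_mon word_eval_rword.
Qed.

Lemma free_eval_linj_rinj f g : ev2 (linj f * rinj g) = tens T (ev f) (ev g).
Proof.
apply: etrans (free_evalM _ _ _) _.
apply: etrans (congr2 *%R (free_eval_linj f) (free_eval_rinj g)) _.
by rewrite tensM !mulr1. Qed.

Lemma linjM f g : linj (f * g) = linj f * linj g.
Proof.
apply: (linear_ext_mon (h := fun g => linj (f * g)) (h' := fun g => linj f * linj g)).
- move=> c u v; apply: etrans (congr1 _ (free_mulr_linear f c u v)) _.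
  exact: linj_linear.
- move=> c u v; apply: etrans (congr1 _ (linj_linear c u v)) _.
  exact: free_mulr_linear.
move=> t; apply: (linear_ext_mon (h := fun f => linj (f * mon k t))
                                 (h' := fun f => linj f * linj (mon k t))).
- move=> c u v; apply: etrans (congr1 _ (free_mull_linear (mon k t) c u v)) _.
  exact: linj_linear.
- move=> c u v.
  apply: etrans (congr1 (fun a => a * linj (mon k t)) (linj_linear c u v)) _.
  exact: free_mull_linear.
by move=> s; rewrite -mon_cat !linj_mon /lword map_cat mon_cat.
Qed.

Lemma rinjM f g : rinj (f * g) = rinj g * rinj f.
Proof.
apply: (linear_ext_mon (h := fun g => rinj (f * g)) (h' := fun g => rinj g * rinj f)).
- move=> c u v; apply: etrans (congr1 _ (free_mulr_linear f c u v)) _.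
  exact: rinj_linear.
- move=> c u v.
  apply: etrans (congr1 (fun a => a * rinj f) (rinj_linear c u v)) _.
  exact: free_mull_linear.
move=> t; apply: (linear_ext_mon (h := fun f => rinj (f * mon k t))
                                 (h' := fun f => rinj (mon k t) * rinj f)).
- move=> c u v; apply: etrans (congr1 _ (free_mull_linear (mon k t) c u v)) _.
  exact: rinj_linear.
- move=> c u v; apply: etrans (congr1 _ (rinj_linear c u v)) _.
  exact: free_mulr_linear.
by move=> s; rewrite -mon_cat !rinj_mon /rword map_cat rev_cat mon_cat.
Qed.

Lemma wdeg_lword s : wdeg env_degs (lword s) = wdeg d s.
Proof.
by rewrite /wdeg big_map; apply: eq_bigr => a _; rewrite /env_degs split_lshift.
Qed.

Lemma wdeg_rword s : wdeg env_degs (rword s) = wdeg d s.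
Proof.
rewrite /wdeg (perm_big _ (permEl (perm_rev _))) big_map.
by apply: eq_bigr => a _; rewrite /env_degs split_rshift.
Qed.

Lemma linj_homog q f : free_homog d q f -> free_homog env_degs q (linj f).
Proof.
move=> hf; apply: (free_alg_ind_supp (S := fun f => free_homog env_degs q (linj f))).
  by apply: preim_subspace linj_linear _; apply: free_homog_subspace.
move=> s /hf <-; rewrite linj_mon -[word_deg _ _]wdeg_lword; exact: free_homog_mon.
Qed.

Lemma rinj_homog q f : free_homog d q f -> free_homog env_degs q (rinj f).
Proof.
move=> hf; apply: (free_alg_ind_supp (S := fun f => free_homog env_degs q (rinj f))).
  by apply: preim_subspace rinj_linear _; apply: free_homog_subspace.
move=> s /hf <-; rewrite rinj_mon -[word_deg _ _]wdeg_rword; exact: free_homog_mon.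
Qed.

(** The bound [C + C] comes from the commutators of two letters, each of degree at most [C]. *)
Definition env_rel (r : F2) :=
  ev2 r = 0 /\ exists2 q, free_homog env_degs q r & (q <= C + C)%N.

Notation J := (ideal_gen env_rel).
Notation "u ~~ v" := (icong env_rel u v) (at level 70).

Lemma free_eval_env_ideal p : J p -> ev2 p = 0.
Proof.
move=> Jp; apply: (Jp (fun p => ev2 p = 0)) => [|r []//].
split=> [|a b a0]; last first.
  by split; rewrite free_evalM a0 ?mul0r ?mulr0.
split=> [|c u v u0 v0]; first exact: free_eval0.
by rewrite free_eval_linear u0 v0 scaler0 addr0.
Qed.

(** [linj] is multiplicative, so the elements it sends into [J] form an ideal, and this ideal
    contains the relations of [A]. *)
Lemma ideal_linj f : ev f = 0 -> J (linj f).
Proof.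
have [_ _ _ _ kerA] := presA; have [subJ idJ] := ideal_gen_ideal env_rel.
move=> f0; apply: (kerA f f0 (fun f => J (linj f))) => [|r [r0 [q hr qC]]].
  split=> [|a b Ja]; first by apply: preim_subspace linj_linear subJ.
  have [Jab Jba] := idJ (linj a) (linj b) Ja.
  by split; rewrite linjM; [exact: Jab | exact: Jba].
move=> S _; apply; split; last first.
  by exists q; [apply: linj_homog | apply: leq_trans qC (leq_addl _ _)].
by rewrite free_eval_linj r0 (linear_fun0 (tens_linl 1)).
Qed.

(** As for [linj], except that [rinj] reverses products and exchanges left and right multiples, to
    which a two-sided ideal is indifferent. *)
Lemma ideal_rinj f : ev f = 0 -> J (rinj f).
Proof.
have [_ _ _ _ kerA] := presA; have [subJ idJ] := ideal_gen_ideal env_rel.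
move=> f0; apply: (kerA f f0 (fun f => J (rinj f))) => [|r [r0 [q hr qC]]].
  split=> [|a b Ja]; first by apply: preim_subspace rinj_linear subJ.
  have [Jab Jba] := idJ (rinj a) (rinj b) Ja.
  by split; rewrite rinjM; [exact: Jba | exact: Jab].
move=> S _; apply; split; last first.
  by exists q; [apply: rinj_homog | apply: leq_trans qC (leq_addl _ _)].
by rewrite free_eval_rinj r0 (linear_fun0 (tens_linr 1)).
Qed.

Lemma letters_commute a b :
  mon k [:: rshift N a; lshift N b] ~~ mon k [:: lshift N b; rshift N a].
Proof.
move=> S _; apply; split.
  apply: etrans (free_evalB _ _ _) _; apply/eqP; rewrite subr_eq0; apply/eqP.
  apply: etrans (free_eval_mon _ _) _; apply: etrans (esym (free_eval_mon _ _)).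
  rewrite /word_eval !big_cons big_nil !mulr1 /env_gens.
  by rewrite split_lshift split_rshift !tensM !mul1r !mulr1.
exists (wdeg env_degs [:: rshift N a; lshift N b]).
  apply: (subspaceB (@free_homog_subspace k _ env_degs _)); first exact: free_homog_mon.
  have -> : wdeg env_degs [:: rshift N a; lshift N b] =
            wdeg env_degs [:: lshift N b; rshift N a].
    by rewrite /wdeg !big_cons !big_nil !addn0 addnC.
  exact: free_homog_mon.
rewrite /wdeg !big_cons big_nil addn0 /env_degs split_lshift split_rshift.
exact: leq_add.
Qed.

Lemma icong_mon_catl w s t : mon k s ~~ mon k t -> mon k (w ++ s) ~~ mon k (w ++ t).
Proof. by move=> st; rewrite (@mon_cat k _ w s) (@mon_cat k _ w t); apply: icong_mull. Qed.

Lemma icong_mon_catr w s t : mon k s ~~ mon k t -> mon k (s ++ w) ~~ mon k (t ++ w).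
Proof. by move=> st; rewrite (@mon_cat k _ s w) (@mon_cat k _ t w); apply: icong_mulr. Qed.

Lemma letter_commute_lword a s :
  mon k (rshift N a :: lword s) ~~ mon k (rcons (lword s) (rshift N a)).
Proof.
elim: s => [|b s IHs]; first exact: icong_refl.
apply: (icong_trans (icong_mon_catr (lword s) (letters_commute a b))).
exact: (icong_mon_catl [:: lshift N b] IHs).
Qed.

(** Right letters move past left letters by [letter_commute_lword]. Degrees are tracked in order to
    place the value of [W] in the right component of the tensor grading. *)
Lemma word_normal_form W : exists s t,
  mon k W ~~ mon k (lword s ++ rword t) /\
  (wdeg d s + wdeg d t = wdeg env_degs W)%N.
Proof.
elim: W => [|i W [s [t [nfW degW]]]].
  by exists [::], [::]; split; [apply: icong_refl | rewrite /wdeg !big_nil].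
have -> : wdeg env_degs (i :: W) = (env_degs i + wdeg env_degs W)%N.
  by rewrite /wdeg big_cons.
have := icong_mon_catl [:: i] nfW; rewrite -(splitK i); case: (split i) => a /= nf.
  exists (a :: s), t; split; first exact: nf.
  by rewrite /env_degs split_lshift -degW addnA /wdeg big_cons.
exists s, (rcons t a); split.
  apply: (icong_trans nf); rewrite /rword map_rcons rev_rcons -cat_rcons.
  exact: (icong_mon_catr (rword t) (letter_commute_lword a s)).
rewrite /env_degs split_rshift -degW addnCA; congr addn.
by rewrite -cats1 wdeg_cat addnC /wdeg big_seq1.
Qed.

Lemma word_eval_lword_rword s t :
  word_eval env_gens (lword s ++ rword t) = tens T (word_eval x s) (word_eval x t).
Proof. by rewrite word_eval_cat word_eval_lword word_eval_rword tensM !mulr1. Qed.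

Lemma free_eval_icong p p' : p ~~ p' -> ev2 p = ev2 p'.
Proof.
by move/free_eval_env_ideal/eqP; rewrite free_evalB subr_eq0 => /eqP.
Qed.

(* By the universal property of the tensor product, a linear section of
   [k<X> -> A] induces a linear section [h] of [k<X,Y> -> T]; every word is
   congruent to its image under [h \o ev2], so the kernel is [env_rel]-generated. *)
Lemma env_section : exists h : T -> F2, [/\ linear h, forall t, ev2 (h t) = t
  & forall p, p ~~ h (ev2 p)].
Proof.
have [_ surjA _ _ _] := presA.
have [sigma [lin_s sK]] := linear_section (free_eval_linear x) surjA.
(* Linearity of [sigma] makes [f] bilinear, as the universal property requires; an arbitrary choice
   of preimages would not do. *)
pose f a b := linj (sigma a) * rinj (sigma b).
have f_l b : linear (f^~ b).
  move=> c u v; apply: etrans (congr1 (fun a => linj a * rinj (sigma b)) (lin_s c u v)) _.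
  apply: etrans (congr1 (fun a => a * rinj (sigma b)) (linj_linear _ _ _)) _.
  exact: free_mull_linear.
have f_r a : linear (f a).
  move=> c u v; apply: etrans (congr1 (fun b => linj (sigma a) * rinj b) (lin_s c u v)) _.
  apply: etrans (congr1 (fun b => linj (sigma a) * b) (rinj_linear _ _ _)) _.
  exact: free_mulr_linear.
have [h [lin_h hE _]] := tens_universal f_l f_r.
have hK t : ev2 (h t) = t.
  (* The universal property is applied to [tens] itself: [ev2 \o h] and the identity agree on pure
     tensors, so both equal [h0]. *)
  have [h0 [_ _ h0_uniq]] := tens_universal tens_linl tens_linr.
  have -> : ev2 (h t) = h0 t.
    apply: (h0_uniq (ev2 \o h)) => [c u v|a b] /=.
      by rewrite lin_h free_eval_linear.
    rewrite hE; apply: etrans (free_eval_linj_rinj _ _) _.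
    by rewrite !sK.
  by apply/esym; apply: (h0_uniq id).
exists h; split=> // p; apply: (free_alg_ind (S := fun p => p ~~ h (ev2 p))) => [|W].
  have [subJ _] := ideal_gen_ideal env_rel.
  apply: (preim_subspace (f := fun p => p - h (ev2 p))) subJ => c u v.
  rewrite (free_eval_linear env_gens c u v) (lin_h c).
  by rewrite scalerBr opprD addrACA.
have [s [t [nf _]]] := word_normal_form W.
rewrite (free_eval_icong nf); apply: (icong_trans nf).
rewrite free_eval_mon word_eval_lword_rword hE.
rewrite mon_cat -linj_mon -rinj_mon.
(* The two factors are replaced one after the other; each time the argument of [linj] or [rinj]
   changes by an element of the kernel of [ev]. *)
apply: (@icong_trans _ _ _ (linj (sigma (word_eval x s)) * rinj (mon k t))).
  apply: icong_mulr; rewrite /icong.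
  suff -> : linj (mon k s) - linj (sigma (word_eval x s)) =
            linj (mon k s - sigma (word_eval x s)).
    by apply: ideal_linj; rewrite free_evalB sK free_eval_mon subrr.
  have -> : mon k s - sigma (word_eval x s) = (-1 : k) *: sigma (word_eval x s) + mon k s.
    by rewrite scaleN1r addrC.
  by rewrite linj_linear scaleN1r addrC.
apply: icong_mull; rewrite /icong.
suff -> : rinj (mon k t) - rinj (sigma (word_eval x t)) =
          rinj (mon k t - sigma (word_eval x t)).
  by apply: ideal_rinj; rewrite free_evalB sK free_eval_mon subrr.
have -> : mon k t - sigma (word_eval x t) = (-1 : k) *: sigma (word_eval x t) + mon k t.
  by rewrite scaleN1r addrC.
by rewrite rinj_linear scaleN1r addrC.
Qed.

Lemma enveloping_presented : presented (@env_gr k A T grA) env_gens env_degs (C + C).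
Proof.
have [gen_deg_gt0 _ lift gr_word _] := presA; have [h [lin_h hK nf]] := env_section.
split=> [i|t|n t grt|W|f f0].
- by rewrite /env_degs; case: (split i).
- by exists (h t); rewrite hK.
- pose S t := exists2 f, free_homog env_degs n f & t = ev2 f.
  apply: (grt S) => [|_ [i [j [a [b [ij /lift[f hf ->] /lift[g hg ->] ->]]]]]].
    split=> [|c _ _ [f hf ->] [g hg ->]].
      by exists 0 => [w|]; [rewrite msupp0 | rewrite free_eval0].
    exists (c *: f + g); last by rewrite free_eval_linear.
    exact: (subspaceZD (@free_homog_subspace k _ env_degs n)).
  exists (linj f * rinj g); last by rewrite free_eval_linj_rinj.
  by rewrite -ij; apply: free_homogM; [apply: linj_homog | apply: rinj_homog].
- have [s [t [/free_eval_icong]]] := word_normal_form W.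
  rewrite !free_eval_mon word_eval_lword_rword => -> degW.
  apply: span_incl; exists (wdeg d s), (wdeg d t), (word_eval x s), (word_eval x t).
  by split.
have := nf f; rewrite f0 (linear_fun0 lin_h) /icong subr0; apply: ideal_gen_mono.
by move=> r [].
Qed.

End Enveloping.

(** * Finitely many shapes, and the conclusion *)

Section NoInfiniteChain.

Lemma infinite_fiber (T : finType) (f : nat -> T) :
  exists t, forall n, exists2 n', (n < n')%N & f n' = t.
Proof.
apply: NNPP => nofib.
have [N hN] : exists N : T -> nat, forall t n', (N t < n')%N -> f n' <> t.
  apply: (choice (fun t n => forall n', (n < n')%N -> f n' <> t)) => t.
  apply: NNPP => not; apply: nofib; exists t => n; apply: NNPP => non.
  by apply: not; exists n => n' nn' ft; apply: non; exists n'.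
apply: (hN (f (\max_t N t).+1) (\max_t N t).+1) => //.
by rewrite ltnS leq_bigmax.
Qed.

(** The common form of the series of modules and bimodules: bounded numerical data and a point [p],
    with no algebra left. *)
Definition rank_series (k : fieldType) (D0 : int) (C : nat) (h : int -> int) :=
  exists (N m : nat) (d : 'I_N -> nat) (e : 'I_m -> int) (p : relcoef C N m -> k),
    [/\ (N <= C)%N /\ (m <= C)%N, forall i, (d i <= C)%N,
        forall j, D0 <= e j <= D0 + C%:Z
      & forall q, h q = (#|basis_word D0 d e q| - \rank (relmx D0 d e p q))%N%:Z].

Lemma basis_word_low (D0 : int) N m (d : 'I_N -> nat) (e : 'I_m -> int) q :
  (forall j, D0 <= e j) -> q < D0 -> #|basis_word D0 d e q| = 0%N.
Proof.
move=> De qD; apply: eq_card0 => x; have /eqP := valP x.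
by have := De (val x).1; rewrite /tdeg /=; lia.
Qed.

Lemma rank_series_no_chain (k : fieldType) (D0 : int) (C : nat) :
  no_infinite_ascending_chain (rank_series k D0 C).
Proof.
move=> [h [hP h_lt]].
(* The numbers and degrees of the generators, the module degrees being counted from [D0]; all are at
   most [C], so there are finitely many shapes. *)
pose shape : finType := ({N : 'I_C.+1 & {ffun 'I_N -> 'I_C.+1}} *
  {m : 'I_C.+1 & {ffun 'I_m -> 'I_C.+1}})%type.
pose dS (s : shape) i : nat := tagged s.1 i.
pose eS (s : shape) j : int := D0 + (tagged s.2 j : nat)%:Z.
have [s sP] : exists s : nat -> shape, forall n,
    exists p : relcoef C (tag (s n).1) (tag (s n).2) -> k, forall q,
    h n q = (#|basis_word D0 (dS (s n)) (eS (s n)) q| -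
             \rank (relmx D0 (dS (s n)) (eS (s n)) p q))%N%:Z.
  apply: (choice (fun n (s : shape) => exists p : relcoef C (tag s.1) (tag s.2) -> k,
    forall q, h n q = (#|basis_word D0 (dS s) (eS s) q| -
                       \rank (relmx D0 (dS s) (eS s) p q))%N%:Z)) => n.
  have [N [m [d [e [p [[NC mC] dC eC hE]]]]]] := hP n.
  pose ffT (n : 'I_C.+1) := {ffun 'I_n -> 'I_C.+1}.
  pose s : shape :=
    (existT ffT (Ordinal (NC : (N < C.+1)%N)) [ffun i => inord (d i)],
     existT ffT (Ordinal (mC : (m < C.+1)%N)) [ffun j => inord `|e j - D0|%N]).
  have dE : dS s = d.
    by apply: functional_extensionality => i; rewrite /dS /= ffunE inordK // ltnS.
  have eE : eS s = e.
    apply: functional_extensionality => j; rewrite /eS /= ffunE.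
    have aux (a : int) : D0 <= a <= D0 + C%:Z ->
      D0 + `|a - D0|%N%:Z = a /\ (`|a - D0| < C.+1)%N by lia.
    by have [e1 e2] := aux _ (eC j); rewrite inordK.
  by exists s; rewrite dE eE; exists p.
(* All series vanish below [D0], so restarting the index at [D0] loses no comparison. *)
pose g n (i : nat) := absz (h n (D0 + i%:Z)).
have h_low n q : q < D0 -> h n q = 0.
  move=> qD; have [p ->] := sP n; congr Posz; apply/eqP; rewrite subn_eq0.
  apply: (@leq_trans 0) => //; rewrite leqn0; apply/eqP/basis_word_low => // j.
  by rewrite /eS; lia.
have h_ge0 n q : 0 <= h n q by have [p ->] := sP n.
have g_lt n : exists q, lex_ltn_at q (g n) (g n.+1).
  have [q [eq_q lt_q]] := h_lt n.
  have [qD|qD] := ltP q D0; first by move: lt_q; rewrite !h_low.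
  exists `|q - D0|%N; split=> [i iq|].
    by rewrite /g eq_q //; lia.
  rewrite /g; have -> : D0 + `|q - D0|%N%:Z = q by lia.
  by have := h_ge0 n q; have := h_ge0 n.+1 q; lia.
(* Passing to members of one shape skips steps of the chain, so comparison of distant members is
   needed. *)
have g_lt_trans n n' : (n < n')%N -> exists q, lex_ltn_at q (g n) (g n').
  move=> /subnKC <-; elim: (n' - n.+1)%N => [|i [q IHi]]; first by rewrite addn0.
  have [r step] := g_lt (n.+1 + i)%N; rewrite addnS.
  by exists (minn q r); apply: lex_ltn_at_trans step.
have [s0 s0P] := infinite_fiber s.
have [nxt nxtP] : exists nxt : nat -> nat, forall n, (n < nxt n)%N /\ s (nxt n) = s0.
  apply: (choice (fun n n' => (n < n')%N /\ s n' = s0)) => n.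
  by have [n' nn' sn'] := s0P n; exists n'.
pose sub i := iter i.+1 nxt 0%N.
have sub_lt i : (sub i < sub i.+1)%N by have [] := nxtP (sub i).
have sub_s i : s (sub i) = s0 by have [] := nxtP (iter i nxt 0%N).
have [p pP] : exists p : nat -> relcoef C (tag s0.1) (tag s0.2) -> k, forall i q,
    h (sub i) q = (#|basis_word D0 (dS s0) (eS s0) q| -
                   \rank (relmx D0 (dS s0) (eS s0) (p i) q))%N%:Z.
  apply: (choice (fun i (p : relcoef C (tag s0.1) (tag s0.2) -> k) => forall q,
    h (sub i) q = (#|basis_word D0 (dS s0) (eS s0) q| -
                   \rank (relmx D0 (dS s0) (eS s0) p q))%N%:Z)) => i.
  by have := sP (sub i); rewrite sub_s.
apply: (@no_lex_chain_of_coranks k (relcoef C (tag s0.1) (tag s0.2))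
  (fun q => #|rel_index D0 C (tag s0.1) (tag s0.2) (D0 + q%:Z)|)
  (fun q => #|basis_word D0 (dS s0) (eS s0) (D0 + q%:Z)|)
  (fun R x q => relmx D0 (dS s0) (eS s0) x (D0 + q%:Z)) p (fun n => g (sub n))).
- by move=> R S f x q; apply: map_relmx.
- by move=> n q; rewrite /g pP absz_nat.
by move=> n; apply: g_lt_trans.
Qed.

Lemma presented_mono (k : fieldType) (B : algType k) grB N (z : 'I_N -> B) d C C' :
  (C <= C')%N -> presented grB z d C -> presented grB z d C'.
Proof.
move=> CC' [? ? ? ? kerB]; split=> // f /kerB; apply: ideal_gen_mono.
move=> r [r0 [q hr qC]]; split=> //; exists q => //; exact: leq_trans CC'.
Qed.

Lemma rank_series_bounded (k : fieldType) (B : algType k) grB N (z : 'I_N -> B) d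
    (M : rmodule B) (gr : int -> M -> Prop) (D0 D : int) (C : nat) h :
  presented grB z d C -> (N <= C)%N -> (forall i, (d i <= C)%N) ->
  D <= C%:Z -> D <= D0 + C%:Z ->
  graded_rmodule grB gr -> mod_bounded grB gr D0 D -> hilbert_series gr h ->
  rank_series k D0 C h.
Proof.
move=> presB NC dC DC DDC grM [m [y [e [R [mD [_ [gen_y _]] y_e [gen_R _] hR]]]]] hM.
have e_ge j : D0 <= e j by have [_ /andP[]] := y_e j.
have gr_y j : gr (e j) (y j) by case: (y_e j).
have [v|v v0|p pP] :=
  @graded_piece_dim k B grB N z d C presB M gr grM m y e D0 e_ge gr_y.
- by apply/gen_y.
- move=> S subS RS; apply: (proj1 (gen_R v) v0 S subS) => r Rr; apply: RS.
  split; first by apply/gen_R => S' _; apply.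
  by have [q hq qD] := hR r Rr; exists q => //; apply: le_trans DDC.
exists N, m, d, e, p; split=> // [|j|q].
- by split=> //; lia.
- by have [_ /andP[-> /le_trans->]] := y_e j.
by have [n dim_n ->] := hM q; congr Posz; apply: pP.
Qed.

End NoInfiniteChain.

Theorem theorem1p2 (k : fieldType) (D0 D : int) (hD : D0 <= D) :
  no_infinite_ascending_chain (E_module_series k D0 D) /\
  no_infinite_ascending_chain (E_bimodule_series k D0 D).
Proof.
(* Twice [|D|] bounds the number of generators of the enveloping algebra and the degrees of its
   relations; [|D - D0|] ensures [D <= D0 + C], since module degrees are counted from [D0]. *)
pose C := (`|D| + `|D| + `|D - D0|)%N.
suff [HM HB] : (forall h, E_module_series k D0 D h -> rank_series k D0 C h) /\
    (forall h, E_bimodule_series k D0 D h -> rank_series k D0 C h).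
  split=> -[h [hP h_lt]]; apply: (@rank_series_no_chain k D0 C); exists h;
    split=> // n; [exact: HM | exact: HB].
split=> h.
  move=> [A [grA [M [grM [[cgA bA] gM bM hM]]]]].
  have [N [x [d [ND dD pres]]]] := alg_bounded_presented cgA bA.
  apply: (rank_series_bounded (presented_mono _ pres) _ _ _ _ gM bM hM); rewrite /C.
  - by lia.
  - by lia.
  - by move=> i; have := dD i; lia.
  - by lia.
  - by lia.
move=> [A [grA [T [M [grM [[cgA bA] gM bM hM]]]]]].
have [N [x [d [ND dD pres]]]] := alg_bounded_presented cgA bA.
have dC i : (d i <= `|D|)%N by have := dD i; lia.
have presT := enveloping_presented T pres dC.
apply: (rank_series_bounded (presented_mono _ presT) _ _ _ _ gM bM hM); rewrite /C.
- by lia.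
- by lia.
- by move=> i; rewrite /env_degs; case: (split i) => a; have := dC a; lia.
- by lia.
- by lia.
Qed.
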